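(* Let $G$ be either the Coulomb kernel on $\mathbb{R}^d$, or the Energy Distance kernel on $\mathbb{R}^d$ with $d$ odd. Let $\mu,\nu$ be probability measures on $\mathbb{R}^d$ with finite $G$-energy, and suppose that $\mu$ is a Lagrangian critical point of the MMD functional $E_\nu$ associated with $G$. Then $$\mu_{|\mathrm{Int}(\mathrm{supp}(\mu))}=\nu_{|\mathrm{Int}(\mathrm{supp}(\mu))}.$$
   Context: The Coulomb kernel on $\mathbb{R}^d$ is $G(x,y)=\frac{1}{(d-2)\|x-y\|^{d-2}}$ (for $d=2$, $G(x,y)=-\log\|x-y\|$); it is, up to a positive constant, the fundamental solution of $-\Delta$. The Energy Distance kernel is $G(x,y)=-\|x-y\|$. A probability measure $\rho$ has finite $G$-energy if $\iint G\,d\rho\otimes d\rho$ is finite. $E_\nu(\mu)=\frac12\iint G(x,y)\,d(\mu-\nu)(x)\,d(\mu-\nu)(y)$. Its first variation at $\mu$ is the locally integrable function $\frac{\delta E_\nu}{\delta\mu}(\mu)=\phi_\mu-\phi_\nu$, where $\phi_\rho(x)=\int G(x,y)\,d\rho(y)$, and its gradient is taken in the distributional sense. The measure $\mu$ is a Lagrangian critical point of a functional $\mathcal F$ if $\nabla\frac{\delta\mathcal F}{\delta\mu}(\mu)=0$ on $\mathrm{supp}(\mu)$. $\mathrm{Int}$ denotes topological interior, and $\mu_{|U}$ the restriction of $\mu$ to $U$. *)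

(* Defs.v *)
From HB Require Import structures.
From mathcomp Require Import all_boot all_order all_algebra.
From mathcomp Require Import all_classical all_reals all_analysis.

Set Implicit Arguments.
Unset Strict Implicit.
Unset Printing Implicit Defensive.

Import Order.TTheory GRing.Theory Num.Theory.
Import numFieldNormedType.Exports.

Local Open Scope classical_set_scope.
Local Open Scope ring_scope.

(* Row vectors with the Borel sigma-algebra. The norm of the library on
   'rV[R]_d is the sup norm; it is only used for its topology. *)
Notation borelRd R d := (g_sigma_algebraType (@open 'rV[R]_d)).

Section borel_Rd.
Context {R : realType}.

Lemma nbhs_rat_itv (x : R) (P : set R) : nbhs x P -> exists p q : rat,
  [/\ ratr p < x, x < ratr q & `](ratr p : R), (ratr q : R)[%classic `<=` P].
Proof.
move=> /nbhs_ballP[e /= e0 eP].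
have [p] := @rat_in_itvoo R (x - e) x ltac:(by rewrite ltrBlDr ltrDl).
rewrite in_itv/= => /andP[p1 p2].
have [q] := @rat_in_itvoo R x (x + e) ltac:(by rewrite ltrDl).
rewrite in_itv/= => /andP[q1 q2].
exists p, q; split => //.
move=> y; rewrite /= in_itv/= => /andP[y1 y2]; apply: eP.
rewrite ball_itv/= in_itv/=; apply/andP; split.
  exact: lt_trans y1.
exact: lt_trans q2.
Qed.

Let box n (a : {ffun 'I_n -> rat * rat}) : set 'rV[R]_n :=
  \bigcap_(i in setT) [set x : 'rV[R]_n | ratr (a i).1 < x 0 i < ratr (a i).2].

Lemma open_bigcup_box n (U : set 'rV[R]_n) : open U ->
  U = \bigcup_(a in [set a | box a `<=` U]) box a.
Proof.
move=> oU; apply/seteqP; split=> [x Ux|x [a /= aU ax]]; last exact: aU.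
have : nbhs x U by apply: open_nbhs_nbhs.
case=> P Px PU.
have /choice[f Hf] : forall i, exists a : rat * rat,
    [/\ ratr a.1 < x 0 i, x 0 i < ratr a.2 &
      `](ratr a.1 : R), (ratr a.2 : R)[%classic `<=` P 0 i].
  by move=> i; have [p [q pq]] := nbhs_rat_itv (Px 0 i); exists (p, q).
exists [ffun i => f i] => /=.
  move=> y ay; apply: PU => i j; rewrite ord1.
  have [_ _] := Hf j; apply; rewrite /= in_itv/=.
  by have := ay j I; rewrite /= ffunE.
by move=> i _ /=; rewrite ffunE; have [-> -> _] := Hf i.
Qed.

Lemma measurable_fun_rV d (T : measurableType d) n (f : T -> borelRd R n) :
  (forall i, measurable_fun setT (fun t => (f t : 'rV[R]_n) 0 i)) ->
  measurable_fun setT f.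
Proof.
move=> mf; apply: (@measurability _ _ T (borelRd R n) setT f (@open 'rV[R]_n)) => //.
move=> _ [U oU <-]; rewrite setTI (open_bigcup_box oU) preimage_bigcup.
rewrite bigcup_mkcond; apply: countable_bigcupT_measurable => // a.
case: ifPn => // _; rewrite preimage_bigcap.
apply: fin_bigcap_measurable => [|i _]; first exact: finite_finset.
have -> : f @^-1` [set x : 'rV[R]_n | ratr (a i).1 < x 0 i < ratr (a i).2] =
    (fun t => (f t : 'rV[R]_n) 0 i) @^-1` `](ratr (a i).1), (ratr (a i).2)[.
  by apply/seteqP; split=> t /=; rewrite in_itv.
by rewrite -[X in measurable X]setTI; apply: mf.
Qed.

Lemma measurable_coord n (i : 'I_n) :
  measurable_fun setT (fun x : borelRd R n => (x : 'rV[R]_n) 0 i).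
Proof.
apply: (@measurability _ _ (borelRd R n) R setT _ (@measurable_realfun.RGenOpens.G R)).
  exact: measurable_realfun.RGenOpens.measurableE.
move=> _ [_ [a [b ->]] <-]; rewrite setTI; apply: sub_sigma_algebra.
move/continuousP : (@coord_continuous R 1 n 0 i); apply; exact: interval_open.
Qed.

End borel_Rd.

Section lebesgue_measure_Rd.
Context {R : realType}.
Local Open Scope ereal_scope.

Definition rV_cons n (p : measurableTypeR R * borelRd R n) : borelRd R n.+1 :=
  row_mx (\row_(i < 1) p.1 : 'rV[R]_1) (p.2 : 'rV[R]_n).

Definition rV_uncons n (x : borelRd R n.+1) :
    measurableTypeR R * borelRd R n :=
  ((x : 'rV[R]_n.+1) ord0 ord0, @rsubmx R 1 1 n x).

Lemma rV_cons0 n r (x : borelRd R n) :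
  (rV_cons (r, x) : 'rV[R]_n.+1) ord0 ord0 = r.
Proof.
have -> : (ord0 : 'I_(1 + n)) = lshift n (ord0 : 'I_1) by exact: val_inj.
by apply: etrans (row_mxEl _ _ _ _) _; rewrite mxE.
Qed.

Lemma rV_consS n r (x : borelRd R n) i :
  (rV_cons (r, x) : 'rV[R]_n.+1) ord0 (lift ord0 i) = (x : 'rV[R]_n) ord0 i.
Proof.
have -> : (lift ord0 i : 'I_(1 + n)) = rshift 1 i by exact: val_inj.
exact: row_mxEr.
Qed.

Lemma rV_consK n : cancel (@rV_cons n) (@rV_uncons n).
Proof.
case=> r x; rewrite /rV_uncons rV_cons0; congr (_, _).
exact: (@row_mxKr R 1 1 n).
Qed.

Lemma measurable_rV_cons n : measurable_fun setT (@rV_cons n).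
Proof.
apply: measurable_fun_rV => i.
have [->|[j ->]] : i = ord0 \/ exists j, i = lift ord0 j.
  by case: (unliftP ord0 i) => [j ->|->]; [right; exists j|left].
  rewrite (_ : (fun _ => _) = fst); first exact: measurable_fst.
  by apply/funext => -[r x]; rewrite rV_cons0.
rewrite (_ : (fun _ => _) = (fun x : borelRd R n => (x : 'rV[R]_n) ord0 j) \o snd).
  by apply: measurableT_comp; [exact: measurable_coord|exact: measurable_snd].
by apply/funext => -[r x]; rewrite rV_consS.
Qed.

HB.instance Definition _ n :=
  isMeasurableFun.Build _ _ _ _ (@rV_cons n) (@measurable_rV_cons n).

Lemma measurable_rV_uncons n : measurable_fun setT (@rV_uncons n).
Proof.
apply/measurable_fun_pair; first exact: measurable_coord.
apply: measurable_fun_rV => j /=.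
under eq_fun do rewrite mxE.
exact: measurable_coord.
Qed.

Section step.
Variables (n : nat) (m : {sigma_finite_measure set (borelRd R n) -> \bar R}).

Definition lebesgue_step : set (borelRd R n.+1) -> \bar R :=
  pushforward (@lebesgue_measure R \x m) (@rV_cons n).

Let step0 : lebesgue_step set0 = 0.
Proof. exact: measure0. Qed.

Let step_ge0 A : 0 <= lebesgue_step A.
Proof. exact: measure_ge0. Qed.

Let step_sigma_additive : semi_sigma_additive lebesgue_step.
Proof. exact: measure_semi_sigma_additive. Qed.

HB.instance Definition _ := isMeasure.Build _ _ _ lebesgue_step
  step0 step_ge0 step_sigma_additive.

Let step_sigma_finite : sigma_finite setT lebesgue_step.
Proof.
have /sigma_finiteP[F [TF ndF Foo]] := sigma_finiteT (@lebesgue_measure R).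
have /sigma_finiteP[G [TG ndG Goo]] := sigma_finiteT m.
exists (fun k => @rV_uncons n @^-1` (F k `*` G k)).
  apply/esym/seteqP; split => // x _.
  have : [set: measurableTypeR R] (rV_uncons x).1 by [].
  have : [set: borelRd R n] (rV_uncons x).2 by [].
  rewrite TG TF => -[k _ Gk] [j _ Fj]; exists (maxn j k) => //; split.
    by move: Fj; exact/subsetPset/ndF/leq_maxl.
  by move: Gk; exact/subsetPset/ndG/leq_maxr.
move=> k; have [mF Fk] := Foo k; have [mG Gk] := Goo k; split.
  rewrite -[X in measurable X]setTI; apply: measurable_rV_uncons => //.
  exact: measurableX.
rewrite /lebesgue_step /pushforward -comp_preimage.
rewrite (_ : _ \o _ = id) ?preimage_id; last first.
  by apply/funext => x /=; rewrite rV_consK.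
by rewrite product_measure1E// lte_mul_pinfty// ge0_fin_numE.
Qed.

HB.instance Definition _ := Measure_isSigmaFinite.Build _ _ _ lebesgue_step
  step_sigma_finite.

End step.

Fixpoint lebesgue_Rd (n : nat) :
    {sigma_finite_measure set (borelRd R n) -> \bar R} :=
  match n with
  | 0 => dirac ((0%R : 'rV[R]_0) : borelRd R 0)
  | n'.+1 => lebesgue_step (lebesgue_Rd n')
  end.

Lemma lebesgue_Rd_box n (a b : 'I_n -> R) : (forall i, a i <= b i)%R ->
  lebesgue_Rd n [set x : 'rV[R]_n | forall i, (a i <= x ord0 i <= b i)%R] =
  (\prod_(i < n) (b i - a i))%:E.
Proof.
elim: n a b => [|n IH] a b ab /=.
  rewrite big_ord0 diracE mem_set//= => -[]//.
rewrite big_ord_recl EFinM -IH; last by move=> i; exact: ab.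
have -> : (b ord0 - a ord0)%:E = lebesgue_measure `[a ord0, b ord0]%classic.
  rewrite lebesgue_measure_itv/= lte_fin; case: ltP => //.
  by have := ab ord0; rewrite le_eqVlt => /predU1P[->|]; rewrite ?subrr// ltNge => /negbTE->.
rewrite -product_measure1E//; last first.
  rewrite (_ : mkset _ = \bigcap_(i in setT) ((fun x : borelRd R n =>
      (x : 'rV[R]_n) ord0 i) @^-1` `[a (lift ord0 i), b (lift ord0 i)])).
    apply: fin_bigcap_measurable => [|i _]; first exact: finite_finset.
    by rewrite -[X in measurable X]setTI; exact: measurable_coord.
  apply/seteqP; split => x /= H i; first by move=> _ /=; rewrite in_itv/=.
  by have := H i I; rewrite /= in_itv.
rewrite /lebesgue_step /pushforward; congr product_measure1.
apply/seteqP; split => -[r x] /=.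
  move=> H; split; first by have := H ord0; rewrite rV_cons0 in_itv.
  by move=> i; have := H (lift ord0 i); rewrite rV_consS.
rewrite in_itv/= => -[Hr H] i.
case: (unliftP ord0 i) => [j ->|->]; first by rewrite rV_consS.
by rewrite rV_cons0.
Qed.

End lebesgue_measure_Rd.

Section distributions.
Context {R : realType} {d : nat}.
Implicit Types (h : 'rV[R]_d -> \bar R) (psi : 'rV[R]_d -> R).

Definition pderiv (i : 'I_d) psi : 'rV[R]_d -> R :=
  fun x => 'D_(delta_mx 0 i) psi x.

Fixpoint is_Ck (k : nat) psi : Prop :=
  match k with
  | 0 => continuous psi
  | k'.+1 => continuous psi /\ forall i : 'I_d,
      (forall x, derivable psi x (delta_mx 0 i)) /\ is_Ck k' (pderiv i psi)
  end.

Definition test_function (A : set 'rV[R]_d) psi : Prop :=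
  let S := closure [set x | psi x != 0] in
  [/\ forall k, is_Ck k psi, compact S & S `<=` A].

Definition distr_pderiv (i : 'I_d) h psi : \bar R :=
  (- \int[lebesgue_Rd d]_x (h x * (pderiv i psi x)%:E))%E.

(* A distribution vanishes on a set when it annihilates the test functions
   supported in that set. *)
Definition distr_grad_vanishes_on (A : set 'rV[R]_d) h : Prop :=
  forall (i : 'I_d) psi, test_function A psi -> distr_pderiv i h psi = 0%E.

End distributions.

Section mmd.
Context {R : realType} {d : nat}.
Implicit Types (G : 'rV[R]_d -> 'rV[R]_d -> \bar R)
  (rho mu nu : probability (borelRd R d) R).

Definition enorm (x : 'rV[R]_d) : R := Num.sqrt (\sum_(i < d) x 0 i ^+ 2).

(* For d = 1 the general formula reads - `|x - y|, including on the diagonal.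
   For d >= 2 the value on the diagonal is +oo: both [lne 0 = -oo] and
   [0^-1 = +oo] hold in \bar R. *)
Definition coulomb_kernel (x y : 'rV[R]_d) : \bar R :=
  let r := enorm (x - y) in
  if d == 1%N then (- r)%:E
  else if d == 2%N then (- lne r%:E)%E
  else (((d%:R - 2) * r ^+ (d - 2))%:E^-1)%E.

Definition energy_distance_kernel (x y : 'rV[R]_d) : \bar R :=
  (- enorm (x - y))%:E.

Definition finite_energy G rho : Prop :=
  (rho \x rho)%E.-integrable setT (fun p : borelRd R d * borelRd R d => G p.1 p.2).

Definition potential G rho (x : 'rV[R]_d) : \bar R := (\int[rho]_y G x y)%E.

(* The first variation at mu of
   E_nu(mu) = 1/2 \iint G(x, y) d(mu - nu)(x) d(mu - nu)(y). *)
Definition mmd_first_variation G nu mu (x : 'rV[R]_d) : \bar R :=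
  (potential G mu x - potential G nu x)%E.

Definition msupport mu : set 'rV[R]_d :=
  [set x | forall U : set 'rV[R]_d, open U -> U x -> (0 < mu U)%E].

(* [dF] is the map sending a measure to the first variation of the functional
   at that measure. *)
Definition lagrangian_critical
    (dF : probability (borelRd R d) R -> 'rV[R]_d -> \bar R) mu : Prop :=
  distr_grad_vanishes_on (msupport mu) (dF mu).

End mmd.

(* Main.v *)
(* Testing the critical point equation against second derivatives of an iterated
   Laplacian of a test function chi supported in the support of mu, and
   exchanging the order of integration, gives
     int (int G(x, y) Delta^(N+1) chi(x) dx) d(mu - nu)(y) = 0.
   The inner integral is C chi(y) with C <> 0: G is a function Phi of the squared
   distance s, and with s replaced by s + e the Laplacians are explicit and the
   integrations by parts elementary. As e -> 0 one has
     Delta s^p -> 2p(d + 2p - 2) s^(p-1)   as long as s^(p-1) is locally integrable,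
   which takes the Energy Distance kernel (p = 1/2) to p = 1 - d/2, where the
   limit is instead that of the approximate identity
     e (s + e)^(-d/2-1), rescaled from (1 + |z|^2)^(-d/2-1).
   Hence mu and nu have the same integral against every such chi, in particular
   against smooth functions converging boundedly to the indicators of open boxes. *)

Require Import Defs.
From mathcomp Require Import all_boot all_order all_algebra.
From mathcomp Require Import all_classical all_reals all_analysis.
From mathcomp Require Import measurable_realfun ring lra.

Set Implicit Arguments.
Unset Strict Implicit.
Unset Printing Implicit Defensive.
Import Order.TTheory GRing.Theory Num.Theory.
Import numFieldNormedType.Exports.

Local Open Scope classical_set_scope.
Local Open Scope ring_scope.

(** * Lebesgue integration on row vectors *)

(** Finite energy makes [G] integrable for mu \x mu, whereas the exchange of integrals involves the
    Lebesgue measure in x. A base point x0 with G(x0, .) integrable for mu bridges the two: for x in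
    a bounded set, |G(x, y)| is at most a multiple of 1 + |G(x0, y)| plus a local singularity in x -
    y, whose integral in x is bounded uniformly in y. The constant C is found without polar
    coordinates or surface integrals. Integration by parts rests on the vanishing of the integral of
    a compactly supported partial derivative. Local integrability of s^(-a/2) for a < d comes from
    the divergence of (x - y) (s + e)^p, and integrability of (1 + |z|^2)^(-d/2-1) from the very
    convergence in which it appears. That last integral stays as a factor of C; only its positivity
    matters. The exponents 1/2, -1/2, ... meet 1 - d/2 exactly when d is odd, and the factors 2p(d +
    2p - 2) met before are nonzero. The Coulomb kernel starts at 1 - d/2, or at the logarithm when d
    = 2, so that N = 0 there. *)

Section continuity.
Context {R : realType} {T : topologicalType}.
Implicit Types f g : T -> R.

Lemma continuous_add f g : continuous f -> continuous g -> continuous (fun x => f x + g x).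
Proof. by move=> cf cg x; apply: cvgD; [exact: cf|exact: cg]. Qed.

Lemma continuous_sub f g : continuous f -> continuous g -> continuous (fun x => f x - g x).
Proof. by move=> cf cg x; apply: cvgB; [exact: cf|exact: cg]. Qed.

Lemma continuous_mul f g : continuous f -> continuous g -> continuous (fun x => f x * g x).
Proof. by move=> cf cg x; apply: cvgM; [exact: cf|exact: cg]. Qed.

Lemma continuous_sum n (F : 'I_n -> T -> R) : (forall i, continuous (F i)) ->
  continuous (fun x => \sum_(i < n) F i x).
Proof.
move=> cF; elim: n F cF => [|n IH] F cF.
  by under eq_fun do rewrite big_ord0; exact: cst_continuous.
under eq_fun do rewrite big_ord_recl.
by apply: continuous_add; [exact: cF|exact: IH].
Qed.

Lemma continuous_normr f : continuous f -> continuous (fun x => `|f x|).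
Proof. by move=> cf x; apply: continuous_comp; [exact: cf|exact: norm_continuous]. Qed.

End continuity.

Section integration_Rd.
Context {R : realType}.

Lemma continuous_measurable_rV n (f : 'rV[R]_n -> R) :
  continuous f -> measurable_fun setT (f : borelRd R n -> R).
Proof.
move=> cf; apply: (@measurability _ _ (borelRd R n) R setT _ (@measurable_realfun.RGenOpens.G R)).
  exact: measurable_realfun.RGenOpens.measurableE.
move=> _ [_ [a [b ->]] <-]; rewrite setTI; apply: sub_sigma_algebra.
by move/continuousP : cf; apply; exact: interval_open.
Qed.

Lemma measurable_open_rV n (U : set 'rV[R]_n) : open U ->
  measurable (U : set (borelRd R n)).
Proof. exact: sub_sigma_algebra. Qed.

Lemma measurable_closed_rV n (U : set 'rV[R]_n) : closed U ->
  measurable (U : set (borelRd R n)).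
Proof.
move=> cU; rewrite -(setCK U); apply: measurableC; apply: measurable_open_rV.
exact: closed_openC.
Qed.

Local Open Scope ereal_scope.

Lemma ge0_integral_RdS n (f : borelRd R n.+1 -> \bar R) :
  measurable_fun setT f -> (forall x, 0 <= f x) ->
  \int[lebesgue_Rd n.+1]_x f x =
  \int[@lebesgue_measure R \x lebesgue_Rd n]_p f (rV_cons p).
Proof.
move=> mf f0.
have := @ge0_integral_pushforward _ _ _ _ R (@rV_cons R n) (@measurable_rV_cons R n)
  (@lebesgue_measure R \x lebesgue_Rd n) setT f measurableT mf (fun x _ => f0 x).
by rewrite preimage_setT.
Qed.

Lemma integrable_RdS n (f : borelRd R n.+1 -> \bar R) :
  (lebesgue_Rd n.+1).-integrable setT f ->
  (@lebesgue_measure R \x lebesgue_Rd n).-integrable setT (fun p => f (rV_cons p)).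
Proof.
move=> /integrableP[mf foo]; apply/integrableP; split.
  by apply: measurableT_comp => //; exact: measurable_rV_cons.
by rewrite -(@ge0_integral_RdS n (fun x => `|f x|))//; exact: measurableT_comp.
Qed.

Lemma integral_RdS n (f : borelRd R n.+1 -> \bar R) :
  (lebesgue_Rd n.+1).-integrable setT f ->
  \int[lebesgue_Rd n.+1]_x f x =
  \int[@lebesgue_measure R \x lebesgue_Rd n]_p f (rV_cons p).
Proof.
move=> fi; have mf := measurable_int _ fi.
have := @integral_pushforward _ _ _ _ R (@rV_cons R n) (@measurable_rV_cons R n)
  (@lebesgue_measure R \x lebesgue_Rd n) setT f mf.
rewrite preimage_setT => ->//.
exact: integrable_RdS.
Qed.

Lemma coord_le_norm n (x : 'rV[R]_n) i : (`|x ord0 i| <= `|x|)%R.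
Proof. by rewrite [leRHS]mx_normrE; apply/le_trans/(le_bigmax _ _ (ord0, i)). Qed.

Lemma norm_le_coord n (x : 'rV[R]_n) (M : R) : (0 <= M)%R ->
  (forall i, `|x ord0 i| <= M)%R -> (`|x| <= M)%R.
Proof.
move=> M0 xM; rewrite [leLHS]mx_normrE; apply/bigmax_leP; split => // -[i j] _ /=.
by rewrite ord1.
Qed.

Lemma lebesgue_Rd_ball_lty n (M : R) :
  lebesgue_Rd n [set x : 'rV[R]_n | `|x| <= M]%R < +oo.
Proof.
have [M0|M0] := leP 0%R M; last first.
  rewrite (_ : mkset _ = set0) ?measure0//; apply/seteqP; split => // x /= xM.
  by have := lt_le_trans M0 (normr_ge0 x); rewrite ltNge xM.
rewrite (_ : mkset _ = [set x : 'rV[R]_n | forall i, (- M <= x ord0 i <= M)%R]).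
  by rewrite lebesgue_Rd_box ?ltry// => i; rewrite (le_trans _ M0)// oppr_le0.
apply/seteqP; split => x /= => [xM i|xM].
  by rewrite -ler_norml (le_trans (coord_le_norm _ _)).
by apply: norm_le_coord => // i; rewrite ler_norml.
Qed.

Lemma closed_ball_rV n (M : R) : closed [set x : 'rV[R]_n | `|x| <= M]%R.
Proof.
rewrite (_ : mkset _ = (fun x : 'rV[R]_n => `|x|%R) @^-1` [set t | t <= M]%R)//.
by apply: closed_comp; [move=> x _; exact: norm_continuous|exact: closed_le].
Qed.

Lemma compact_ball_rV n (M : R) : compact [set x : 'rV[R]_n | `|x| <= M]%R.
Proof.
apply: bounded_closed_compact; last exact: closed_ball_rV.
exists M; split; first exact: num_real.
by move=> N MN x /= xM; rewrite (le_trans xM)// ltW.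
Qed.

(** A point is a degenerate box. In dimension 0 the measure is a Dirac mass, hence [n.+1]. *)
Lemma lebesgue_Rd_set1 n (y : 'rV[R]_n.+1) : lebesgue_Rd n.+1 [set y] = 0.
Proof.
rewrite (_ : [set y] = [set x : 'rV[R]_n.+1 | forall i, (y ord0 i <= x ord0 i <= y ord0 i)%R]).
  by rewrite lebesgue_Rd_box// big_ord_recl subrr mul0r.
apply/seteqP; split => x /= => [-> i|H]; first by rewrite lexx.
by apply/rowP => i; apply/eqP; rewrite eq_le andbC H.
Qed.

(** The space C_c of continuous functions with compact support. A bound on the support is equivalent
    to compactness on row vectors, and passes directly to slices, dilations and derivatives. *)
Definition Cc n (f : 'rV[R]_n -> R) :=
  continuous f /\ exists M, forall x, (M < `|x|)%R -> f x = 0%R.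

Lemma Cc_bounded n (f : 'rV[R]_n -> R) : Cc f ->
  exists C, (0 <= C)%R /\ forall x, (`|f x| <= C)%R.
Proof.
move=> [cf [M fM]].
have [N [_ HN]] : bounded_set (f @` [set x : 'rV[R]_n | `|x| <= M]%R).
  apply: compact_bounded; apply: continuous_compact; last exact: compact_ball_rV.
  exact: continuous_subspaceT.
exists (`|N| + 1)%R; split => [|x]; first by rewrite addr_ge0.
have [xM|xM] := leP `|x|%R M; last by rewrite fM// normr0 addr_ge0.
by apply: HN; [rewrite (le_lt_trans (ler_norm _))// ltrDl|exists x].
Qed.

Lemma bounded_supp_integrable n (f : borelRd R n -> R) (C M : R) :
  measurable_fun setT f -> (forall x, `|f x| <= C)%R ->
  (forall x : 'rV[R]_n, M < `|x| -> f x = 0)%R ->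
  (lebesgue_Rd n).-integrable setT (EFin \o f).
Proof.
move=> mf fC fM.
have mB := measurable_closed_rV (@closed_ball_rV n M).
have -> : (EFin \o f) = (EFin \o f) \_ [set x : 'rV[R]_n | `|x| <= M]%R.
  apply/funext => x; rewrite patchE; case: ifPn => //; rewrite notin_setE /=.
  by move/negP; rewrite -ltNge => /fM ->.
rewrite -integrable_mkcond//.
apply: measurable_bounded_integrable => //; first exact: lebesgue_Rd_ball_lty.
  exact: measurable_funTS.
exists C; split; first exact: num_real.
by move=> N CN x _ /=; rewrite (le_trans (fC x))// ltW.
Qed.

Lemma Cc_integrable n (f : 'rV[R]_n -> R) : Cc f ->
  (lebesgue_Rd n).-integrable setT (EFin \o (f : borelRd R n -> R)).
Proof.
move=> fc; have [C [_ fC]] := Cc_bounded fc; case: fc => cf [M fM].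
by apply: (bounded_supp_integrable _ fC fM); exact: continuous_measurable_rV.
Qed.


Lemma continuous_rV (T : topologicalType) n (F : T -> 'rV[R]_n) :
  (forall i, continuous (fun t => F t ord0 i)) -> continuous F.
Proof.
move=> cF t U [P PF PU].
rewrite nbhs_filterE /=.
have : \forall s \near t, forall i : 'I_n, P ord0 i (F s ord0 i).
  apply: filter_forall => i; exact: (cF i t).
apply: filterS => s Ps; apply: PU => i j; rewrite ord1.
exact: Ps.
Qed.

Lemma continuous_rV_cons_l n (x : 'rV[R]_n) :
  continuous (fun r : R => rV_cons (r, x) : 'rV[R]_n.+1).
Proof.
apply: continuous_rV => i; case: (unliftP ord0 i) => [j ->|->].
  by under eq_fun do rewrite rV_consS; exact: cst_continuous.
by under eq_fun do rewrite rV_cons0; move=> r; exact: cvg_id.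
Qed.

Lemma continuous_rV_cons_r n (r : R) :
  continuous (fun x : 'rV[R]_n => rV_cons (r, x) : 'rV[R]_n.+1).
Proof.
apply: continuous_rV => i; case: (unliftP ord0 i) => [j ->|->].
  by under eq_fun do rewrite rV_consS; exact: coord_continuous.
by under eq_fun do rewrite rV_cons0; exact: cst_continuous.
Qed.

(** A derivative in the direction [v] depends only on the values along one line, so it can be
    carried between different spaces: from row vectors to their slices, and from a normed space to
    R. *)
Lemma is_derive_line (V1 V2 : normedModType R) (f1 : V1 -> R) (f2 : V2 -> R)
    (a1 v1 : V1) (a2 v2 : V2) (l : R) :
  (forall h : R, f1 (h *: v1 + a1) = f2 (h *: v2 + a2))%R ->
  is_derive a1 v1 f1 l -> is_derive a2 v2 f2 l.
Proof.
move=> f12 [d1 d1l].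
have E : (fun h : R => h^-1 *: ((f1 \o shift a1) (h *: v1) - f1 a1))%R =
         (fun h : R => h^-1 *: ((f2 \o shift a2) (h *: v2) - f2 a2))%R.
  apply/funext => h /=; rewrite f12.
  by have := f12 0%R; rewrite !scale0r !add0r => ->.
split; first by move: d1; rewrite /derivable E.
by rewrite -d1l /derive E.
Qed.

Lemma is_derive_unique (V : normedModType R) (f : V -> R) (a v : V) (l l' : R) :
  is_derive a v f l -> is_derive a v f l' -> l = l'.
Proof. by move=> [_ <-] [_ <-]. Qed.

Lemma derive_outside_support (V : normedModType R) (f : V -> R) (x v : V) (l M : R) :
  (forall x, (M < `|x|)%R -> f x = 0%R) -> is_derive x v f l ->
  (M < `|x|)%R -> l = 0%R.
Proof.
move=> fM fl Mx; have [v0|v0] := eqVneq v 0%R.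
  by move: fl; rewrite v0 => fl; apply: (is_derive_unique fl); exact: is_derive0.
apply: (is_derive_unique fl).
apply: (@near_eq_is_derive _ _ _ (cst 0%R) f) => //.
have : \forall y \near x, (M < `|y|)%R.
  by apply: (cvgr_gt `|x|%R) => //; apply: norm_continuous.
by apply: filterS => y /fM.
Qed.

Lemma integral_derive_compact (f g : R -> R) (M : R) :
  (forall x : R, is_derive x (1%R : R) f (g x)) -> continuous g ->
  (forall x, (M < `|x|)%R -> f x = 0%R) ->
  \int[lebesgue_measure]_x (g x)%:E = 0.
Proof.
move=> df cg fM; have gM x : (M < `|x|)%R -> g x = 0%R.
  exact: derive_outside_support.
pose N := (`|M| + 1)%R.
have MN : (M < N)%R by rewrite (le_lt_trans (ler_norm _))// ltrDl.
have N0 : (0 < N)%R by rewrite ltr_wpDl.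
transitivity (\int[lebesgue_measure]_(x in `[(- N)%R, N]) (g x)%:E).
  rewrite [RHS]integral_mkcond; apply: eq_integral => x _.
  rewrite patchE; case: ifPn => //; rewrite notin_setE /= in_itv /= -ler_norml.
  by move/negP; rewrite -ltNge => Nx; rewrite gM// (lt_trans MN).
have cf : continuous f.
  by move=> x; apply/differentiable_continuous/derivable1_diffP; case: (df x).
rewrite (@continuous_FTC2 _ g f).
- rewrite !fM ?subee// ?normrN ger0_norm// ltW//.
- by rewrite gtrN.
- exact: continuous_subspaceT.
- split; first by move=> x _; case: (df x).
  + by apply: cvg_at_right_filter; exact: cf.
  + by apply: cvg_at_left_filter; exact: cf.
- by move=> x _; rewrite derive1E; case: (df x).
Qed.

Lemma Cc_derive n (f g : 'rV[R]_n -> R) (v : 'rV[R]_n) :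
  Cc f -> (forall x, is_derive x v f (g x)) -> continuous g -> Cc g.
Proof.
move=> [cf [M fM]] df cg; split => //; exists M => x.
exact: derive_outside_support.
Qed.

Lemma rV_cons_normr n r (x : 'rV[R]_n) : (`|x| <= `|rV_cons (r, x) : 'rV[R]_n.+1|)%R.
Proof.
apply: norm_le_coord => // i; rewrite -(rV_consS r x).
exact: (@coord_le_norm n.+1).
Qed.

Lemma rV_cons_norml n r (x : 'rV[R]_n) : (`|r| <= `|rV_cons (r, x) : 'rV[R]_n.+1|)%R.
Proof. rewrite -{1}(rV_cons0 r x); exact: (@coord_le_norm n.+1). Qed.

Lemma scaleD_mxE n (h : R) (a b : 'rV[R]_n) k :
  (h *: a + b)%R ord0 k = (h * a ord0 k + b ord0 k)%R.
Proof. by rewrite !mxE. Qed.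

(** Fubini: if the differentiated coordinate is the leading one, it is integrated first, by the
    fundamental theorem of calculus; otherwise the leading coordinate is frozen and the induction
    hypothesis applies to the slice. *)
Lemma integral_pderiv_compact n (f g : 'rV[R]_n -> R) (i : 'I_n) : Cc f ->
  (forall x, is_derive x (delta_mx 0%R i) f (g x)) -> continuous g ->
  \int[lebesgue_Rd n]_x (g x)%:E = 0.
Proof.
elim: n f g i => [|n IH] f g i; first by case: i.
move=> cf df cg.
have cg' : Cc g by exact: Cc_derive df cg.
have ig := Cc_integrable cg'.
rewrite (integral_RdS ig); have ig' := integrable_RdS ig.
case: cf => cf [M fM].
case: (unliftP ord0 i) => [j ij|i0].
- rewrite -integral12_prod_meas1//=.
  apply: integral0_eq => r _; rewrite /fubini_F /=.
  apply: (IH (fun x => f (rV_cons (r, x))) _ j).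
  + split; first by move=> x; apply: continuous_comp; [exact: continuous_rV_cons_r|exact: cf].
    exists M => x Mx; apply: fM; apply: (lt_le_trans Mx); exact: rV_cons_normr.
  + move=> x; apply: is_derive_line (df (rV_cons (r, x))) => h; congr f.
    apply/rowP => k; rewrite ij scaleD_mxE.
    case: (unliftP ord0 k) => [k' ->|->].
      by rewrite !rV_consS scaleD_mxE !mxE/= (inj_eq lift_inj).
    by rewrite !rV_cons0 mxE /= mulr0 add0r.
  + by move=> x; apply: continuous_comp; [exact: continuous_rV_cons_r|exact: cg].
- rewrite -integral21_prod_meas1//=.
  apply: integral0_eq => x _; rewrite /fubini_G /=.
  apply: (@integral_derive_compact (fun r => f (rV_cons (r, x))) _ M).
  + move=> r; apply: is_derive_line (df (rV_cons (r, x))) => h; congr f.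
    apply/rowP => k; rewrite i0 scaleD_mxE.
    case: (unliftP ord0 k) => [k' ->|->].
      by rewrite !rV_consS mxE /= mulr0 add0r.
    by rewrite !rV_cons0 mxE.
  + by move=> r; apply: continuous_comp; [exact: continuous_rV_cons_l|exact: cg].
  + move=> r Mr; apply: fM; apply: (lt_le_trans Mr); exact: rV_cons_norml.
Qed.

End integration_Rd.

(** * Change of variables under dilations and translations *)

Section affine.
Context {R : realType}.
Local Open Scope ereal_scope.

Lemma ge0_integral_affine1 (f : R -> R) (y e : R) : (0 < e)%R ->
  continuous f -> (forall x, 0 <= f x)%R ->
  \int[lebesgue_measure]_x (f x)%:E =
  e%:E * \int[lebesgue_measure]_x (f (e * x + y)%R)%:E.
Proof.
move=> e0 cf f0.
pose F := (fun x : R => e * x + y)%R.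
have dF x : is_derive x (1%R : R) F e.
  by rewrite /F; apply: is_derive_eq; rewrite addr0 /GRing.scale /= mulr1.
have F'E : F^`()%classic = cst e.
  by apply/funext => x; rewrite derive1E; case: (dF x).
rewrite (@increasing_ge0_integration_by_substitutionT _ F f).
- rewrite F'E -ge0_integralZl//.
  + by apply: eq_integral => x _ /=; rewrite -EFinM mulrC.
  + apply/measurable_EFinP; apply: continuous_measurable_fun => x.
    apply: continuous_comp; last exact: cf.
    by apply: cvgD; [apply: cvgM; [exact: cvg_cst|exact: cvg_id]|exact: cvg_cst].
  + by move=> x _; rewrite lee_fin.
  + by rewrite lee_fin ltW.
- by move=> a b ab; rewrite /F ltrD2r ltr_pM2l.
- by rewrite F'E; exact: cst_continuous.
- by rewrite F'E; exact: is_cvg_cst.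
- by rewrite F'E; exact: is_cvg_cst.
- by move=> x; case: (dF x).
- apply/cvgrNyPle => A; apply: filterS (nbhs_ninfty_le (num_real (e^-1 * (A - y)))) => x.
  by rewrite /F -lerBrDr -ler_pdivlMl.
- apply/cvgryPge => A; apply: filterS (nbhs_pinfty_ge (num_real (e^-1 * (A - y)))) => x.
  by rewrite /F -lerBlDr -ler_pdivrMl.
- exact: cf.
- exact: f0.
Qed.

Lemma scaleD_rV_cons n (e : R) r (x : 'rV[R]_n) (y : 'rV[R]_n.+1) :
  (e *: (rV_cons (r, x) : 'rV[R]_n.+1) + y =
   rV_cons (e * r + (rV_uncons y).1, e *: x + (rV_uncons y).2))%R.
Proof.
apply/rowP => k; rewrite scaleD_mxE.
case: (unliftP ord0 k) => [k' ->|->]; last by rewrite !rV_cons0.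
rewrite !rV_consS /= scaleD_mxE mxE.
congr (_ + _)%R; apply: (f_equal (y ord0)); exact: val_inj.
Qed.

Lemma continuous_affine n (e : R) (z : 'rV[R]_n) :
  continuous (fun x : 'rV[R]_n => e *: x + z)%R.
Proof.
apply: continuous_rV => i; under eq_fun do rewrite scaleD_mxE.
apply: continuous_add; last exact: cst_continuous.
by apply: continuous_mul; [exact: cst_continuous|exact: coord_continuous].
Qed.

(** Tonelli treats the coordinates one at a time: the leading one gives a factor e, the induction on
    the others e^n. Nonnegativity spares any integrability check on the slices. *)
Lemma ge0_integral_affine n (f : 'rV[R]_n -> R) (y : 'rV[R]_n) (e : R) : (0 < e)%R ->
  continuous f -> (forall x, 0 <= f x)%R ->
  \int[lebesgue_Rd n]_x (f x)%:E =
  (e ^+ n)%:E * \int[lebesgue_Rd n]_x (f (e *: x + y)%R)%:E.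
Proof.
move=> e0; elim: n f y => [|n IH] f y cf f0.
  rewrite expr0 mul1e; apply: eq_integral => x _; congr (f _)%:E.
  by apply/rowP; case.
have cfA : continuous (fun x : 'rV[R]_n.+1 => f (e *: x + y)%R).
  by move=> x; apply: continuous_comp; [exact: continuous_affine|exact: cf].
have mf : measurable_fun setT (fun x : borelRd R n.+1 => (f x)%:E).
  by apply/measurable_EFinP; exact: continuous_measurable_rV.
have mfA : measurable_fun setT (fun x : borelRd R n.+1 => (f (e *: (x : 'rV[R]_n.+1) + y)%R)%:E).
  by apply/measurable_EFinP; exact: continuous_measurable_rV.
have mc := @measurable_rV_cons R n.
rewrite (ge0_integral_RdS mf)//.
rewrite (ge0_integral_RdS mfA)//.
rewrite (@fubini_tonelli2 _ _ _ _ _ _ _ (fun p => (f (rV_cons p))%:E)); last 2 first.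
  by move: mf => /measurableT_comp; apply.
  by move=> x; rewrite lee_fin.
rewrite /fubini_G.
under eq_integral => x _.
  rewrite (@ge0_integral_affine1 (fun r => f (rV_cons (r, x))) (rV_uncons y).1 e)//; last first.
    by move=> r; apply: continuous_comp; [exact: continuous_rV_cons_l|exact: cf].
  over.
have mg : measurable_fun setT (fun p : measurableTypeR R * borelRd R n =>
    (f (rV_cons (e * p.1 + (rV_uncons y).1, p.2)%R))%:E).
  apply: (measurableT_comp mf); apply: (measurableT_comp mc) => /=.
  apply/measurable_fun_pair => /=; last exact: measurable_snd.
  apply: measurable_funD => //; apply: measurable_funM => //; exact: measurable_fst.
rewrite ge0_integralZl//; first last.
- by rewrite lee_fin ltW.
- by move=> x _; apply: integral_ge0 => r _; rewrite lee_fin.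
- apply: (@measurable_fun_fubini_tonelli_G _ _ _ _ _ (@lebesgue_measure R) _ mg) => p.
  by rewrite lee_fin.
rewrite exprS EFinM -muleA; congr (_ * _).
have mg0 p : 0 <= (f (rV_cons (e * p.1 + (rV_uncons y).1, p.2)%R))%:E by rewrite lee_fin.
apply: etrans (esym (@fubini_tonelli _ _ _ _ _ (@lebesgue_measure R) (lebesgue_Rd n) _ mg mg0)) _.
under eq_integral => r _.
  rewrite /= (IH (fun x => f (rV_cons (e * r + (rV_uncons y).1, x)%R)) (rV_uncons y).2)//; last first.
    by move=> x; apply: continuous_comp; [exact: continuous_rV_cons_r|exact: cf].
  over.
have mh : measurable_fun setT (fun p : measurableTypeR R * borelRd R n =>
    (f (e *: (rV_cons p : 'rV[R]_n.+1) + y)%R)%:E).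
  exact: (measurableT_comp mfA).
have mh0 p : 0 <= (f (e *: (rV_cons p : 'rV[R]_n.+1) + y)%R)%:E by rewrite lee_fin.
rewrite (@fubini_tonelli1 _ _ _ _ _ (@lebesgue_measure R) (lebesgue_Rd n) _ mh mh0).
have E r : \int[lebesgue_Rd n]_x (f (rV_cons (e * r + (rV_uncons y).1, (e *: (x : 'rV[R]_n) + (rV_uncons y).2))%R))%:E =
   fubini_F (lebesgue_Rd n) (fun p => (f (e *: (rV_cons p : 'rV[R]_n.+1) + y)%R)%:E) r.
  by apply: eq_integral => x _; rewrite scaleD_rV_cons.
under eq_integral do rewrite E.
rewrite ge0_integralZl//; first last.
- by rewrite lee_fin exprn_ge0// ltW.
- by move=> r _; apply: integral_ge0 => x _; rewrite lee_fin.
- apply: (@measurable_fun_fubini_tonelli_F _ _ _ _ _ (lebesgue_Rd n) _ mh) => p.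
  by rewrite lee_fin.
by move=> x; rewrite lee_fin.
Qed.

Lemma Cc_affine n (g : 'rV[R]_n -> R) (y : 'rV[R]_n) (e : R) : (0 < e)%R ->
  Cc g -> Cc (fun x : 'rV[R]_n => g (e *: x + y)%R).
Proof.
move=> e0.
move=> [cg [N gN]]; split.
  by move=> x; apply: continuous_comp; [exact: continuous_affine|exact: cg].
exists ((N + `|y|) / e)%R => x; rewrite ltr_pdivrMr// => xN; apply: gN.
rewrite -(ltrD2r `|y|%R); apply: (lt_le_trans xN).
rewrite (_ : `|x| * e = `|e *: x|)%R; last by rewrite normrZ gtr0_norm// mulrC.
by rewrite -{1}(addrK y (e *: x)%R); exact: ler_normB.
Qed.

Lemma integral_affine n (f : 'rV[R]_n -> R) (y : 'rV[R]_n) (e : R) : (0 < e)%R ->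
  Cc f ->
  \int[lebesgue_Rd n]_x (f x)%:E =
  (e ^+ n)%:E * \int[lebesgue_Rd n]_x (f (e *: x + y)%R)%:E.
Proof.
move=> e0 [cf [M fM]].
have cnf : continuous (fun x => `|f x|)%R.
  exact: continuous_normr.
(* Twice the positive and negative parts of [f]; both stay continuous with compact support. *)
pose p (x : 'rV[R]_n) : R := (`|f x| + f x)%R; pose m (x : 'rV[R]_n) : R := (`|f x| - f x)%R.
have p0 x : (0 <= p x)%R by rewrite /p -lerBlDr sub0r -normrN ler_norm.
have m0 x : (0 <= m x)%R by rewrite /m subr_ge0 ler_norm.
have cp : continuous p by exact: continuous_add.
have cm : continuous m by exact: continuous_sub.
have fE x : (f x)%:E = 2^-1%:E * ((p x)%:E - (m x)%:E).
  by rewrite -EFinB -EFinM /p /m; congr EFin; field.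
have Ccp : Cc p by split => //; exists M => x /fM fx; rewrite /p fx normr0 addr0.
have Ccm : Cc m by split => //; exists M => x /fM fx; rewrite /m fx normr0 subr0.
have CcA g : Cc g -> Cc (fun x : 'rV[R]_n => g (e *: x + y)%R) by exact: Cc_affine.
have I g : Cc g -> (lebesgue_Rd n).-integrable setT (fun x : borelRd R n => (g x)%:E).
  exact: Cc_integrable.
under eq_integral do rewrite fE.
under [in RHS]eq_integral do rewrite fE.
have ipm := integrableB measurableT (I _ Ccp) (I _ Ccm).
have ipmA := integrableB measurableT (I _ (CcA _ Ccp)) (I _ (CcA _ Ccm)).
rewrite integralZl// integralZl// muleCA integralB//; [|exact: I..].
rewrite integralB//; [|exact/I/CcA..].
congr (_ * _); rewrite (ge0_integral_affine y e0 cp p0) (ge0_integral_affine y e0 cm m0).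
have fin : \int[lebesgue_Rd n]_x (p (e *: x + y)%R)%:E \is a fin_num.
  by apply: integrable_fin_num => //; exact: (I _ (CcA _ Ccp)).
have dist (a : R) (b c : \bar R) : b \is a fin_num -> a%:E * b - a%:E * c = a%:E * (b - c).
  by move=> bfin; rewrite muleBr// fin_num_adde_defr.
exact: dist.
Qed.

End affine.

(** * Smooth functions and bumps *)

Section smooth.
Context {R : realType}.

(** Along the line through [x] in the direction [v] this is the one-variable chain rule; a
    directional derivative of [f] suffices. *)
Lemma is_derive_comp1 (V : normedModType R) (f : V -> R) (g : R -> R) (x v : V) (l m : R) :
  is_derive x v f l -> is_derive (f x) (1 : R) g m ->
  is_derive x v (fun y => g (f y)) (m * l).
Proof.
move=> df dg; pose phi (h : R) := f (h *: v + x).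
have dphi : is_derive (0 : R) (1 : R) phi l.
  by apply: is_derive_line df => h; rewrite /phi /GRing.scale /= mulr1 addr0.
have phi0 : phi 0 = f x by rewrite /phi scale0r add0r.
rewrite -phi0 in dg; apply: is_derive_line (is_derive1_comp dg dphi) => h /=.
by rewrite /phi /GRing.scale /= mulr1 addr0.
Qed.

Lemma is_derive_coord n (x v : 'rV[R]_n) i :
  is_derive x v (fun y : 'rV[R]_n => y 0 i) (v 0 i).
Proof.
have : is_derive (x 0 i) (v 0 i) (fun t : R => t) (v 0 i) by exact: is_derive_id.
by apply: is_derive_line => h; rewrite scaleD_mxE.
Qed.

Context {d : nat}.
Implicit Types f g : 'rV[R]_d -> R.

Definition smooth f := forall k, is_Ck k f.

Lemma is_Ck_continuous k f : is_Ck k f -> continuous f.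
Proof. by case: k => [|k] //= []. Qed.

Lemma is_CkW k f : is_Ck k.+1 f -> is_Ck k f.
Proof.
elim: k f => [|k IH] f [cf Hf] //=; split => // i; have [df Hp] := Hf i.
by split => //; exact: IH.
Qed.

Lemma is_Ck_is_derive k f i x : is_Ck k.+1 f ->
  is_derive x (delta_mx 0 i) f (pderiv i f x).
Proof. by move=> [_ Hf]; apply/derivableP; case: (Hf i) => + _; apply. Qed.

Lemma pderivE f i (l : 'rV[R]_d -> R) :
  (forall x, is_derive x (delta_mx 0 i) f (l x)) -> pderiv i f = l.
Proof. by move=> df; apply/funext => x; rewrite /pderiv; case: (df x). Qed.

Lemma is_CkS k f : continuous f ->
  (forall i, exists2 l, (forall x, is_derive x (delta_mx 0 i) f (l x)) & is_Ck k l) ->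
  is_Ck k.+1 f.
Proof.
move=> cf Hf; split => // i; have [l df Hl] := Hf i; split.
  by move=> x; case: (df x).
by rewrite (pderivE df).
Qed.

Lemma is_Ck_cst k (c : R) : is_Ck k (fun _ : 'rV[R]_d => c).
Proof.
elim: k c => [|k IH] c; first exact: cst_continuous.
apply: is_CkS => [|i]; first exact: cst_continuous.
by exists (fun=> 0) => // x; exact: is_derive_cst.
Qed.

Lemma is_CkD k f g : is_Ck k f -> is_Ck k g -> is_Ck k (fun x => f x + g x).
Proof.
elim: k f g => [|k IH] f g Hf Hg; first exact: continuous_add.
apply: is_CkS => [|i].
  by apply: continuous_add; apply: is_Ck_continuous; [exact: Hf|exact: Hg].
exists (fun x => pderiv i f x + pderiv i g x).
  by move=> x; apply: is_deriveD; [exact: is_Ck_is_derive Hf|exact: is_Ck_is_derive Hg].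
by apply: IH; [case: Hf => _ /(_ i)[]|case: Hg => _ /(_ i)[]].
Qed.

Lemma is_CkM k f g : is_Ck k f -> is_Ck k g -> is_Ck k (fun x => f x * g x).
Proof.
elim: k f g => [|k IH] f g Hf Hg; first exact: continuous_mul.
apply: is_CkS => [|i].
  by apply: continuous_mul; apply: is_Ck_continuous; [exact: Hf|exact: Hg].
exists (fun x => f x * pderiv i g x + g x * pderiv i f x).
  move=> x; apply: (is_derive_eq (f := f * g)).
  by apply: is_deriveM; [exact: is_Ck_is_derive Hf|exact: is_Ck_is_derive Hg].
  by [].

apply: is_CkD; apply: IH.
- exact: is_CkW.
- by case: Hg => _ /(_ i)[].
- exact: is_CkW.
- by case: Hf => _ /(_ i)[].
Qed.

Lemma smooth_prod n (F : 'I_n -> 'rV[R]_d -> R) : (forall i, smooth (F i)) ->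
  smooth (fun x => \prod_(i < n) F i x).
Proof.
move=> sF k; elim: n F sF => [|n IH] F sF.
  by under eq_fun do rewrite big_ord0; exact: is_Ck_cst.
under eq_fun do rewrite big_ord_recl.
by apply: is_CkM; [exact: sF|apply: IH].
Qed.

Lemma smooth_sum n (F : 'I_n -> 'rV[R]_d -> R) : (forall i, smooth (F i)) ->
  smooth (fun x => \sum_(i < n) F i x).
Proof.
move=> sF k; elim: n F sF => [|n IH] F sF.
  by under eq_fun do rewrite big_ord0; exact: is_Ck_cst.
under eq_fun do rewrite big_ord_recl.
by apply: is_CkD; [exact: sF|apply: IH].
Qed.

Lemma smooth_pderiv i f : smooth f -> smooth (pderiv i f).
Proof. by move=> sf k; have [_ /(_ i)[]] := sf k.+1. Qed.

Lemma smooth_is_derive i f x : smooth f -> is_derive x (delta_mx 0 i) f (pderiv i f x).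
Proof. by move=> sf; exact: is_Ck_is_derive (sf 1%N). Qed.

Lemma smooth_continuous f : smooth f -> continuous f.
Proof. by move=> /(_ 0%N). Qed.

(** [D] lists a function of one variable with its successive derivatives. Each differentiation moves
    one step along the list, so the induction on [k] has to treat all the [D m] at once. *)
Lemma smooth_coord (D : nat -> R -> R) (a b : R) (i : 'I_d) :
  (forall n t, is_derive t (1 : R) (D n) (D n.+1 t)) ->
  smooth (fun x => D 0%N (a * x 0 i + b)).
Proof.
move=> dD k.
suff H m : is_Ck k (fun x : 'rV[R]_d => D m (a * x 0 i + b)) by exact: H.
elim: k m => [|k IH] m.
  have cD : continuous (D m).
    by move=> t; apply/differentiable_continuous/derivable1_diffP; case: (dD m t).
  move=> x; apply: continuous_comp; last exact: cD.
  apply: continuous_add; last exact: cst_continuous.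
  by apply: continuous_mul; [exact: cst_continuous|exact: coord_continuous].
apply: is_CkS; first exact: is_Ck_continuous (IH m).
move=> j; exists (fun x : 'rV[R]_d => D m.+1 (a * x 0 i + b) * (a * (delta_mx 0 j : 'rV[R]_d) 0 i)).
  move=> x; apply: is_derive_comp1 => //.
  have dx := is_derive_coord x (delta_mx 0 j) i.
  apply: (@is_derive_eq _ _ _ (fun y : 'rV[R]_d => a *: (y 0 i) + b)); rewrite addr0//.
by apply: is_CkM; [exact: IH|exact: is_Ck_cst].
Qed.

End smooth.

(** * The function exp(-1/t) and smooth approximations of indicators of boxes *)

Section bump.
Context {R : realType}.
Implicit Types (p : {poly R}) (t u : R).

Lemma exprn_le_expR n u : 0 <= u -> u ^+ n <= n`!%:R * expR u.
Proof.
move=> u0; case: n => [|n].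
  by rewrite expr0 fact0 mul1r -expR0 ler_expR.
rewrite mulrC -ler_pdivrMr ?ltr0n ?fact_gt0//.
by apply: le_trans (expR_ge1Dxn n u0); rewrite lerDr.
Qed.

Lemma horner_le_expR p : exists2 C, 0 <= C & forall u, 0 <= u -> `|p.[u]| <= C * expR u.
Proof.
exists (\sum_(i < size p) `|p`_i| * i`!%:R).
  by apply: sumr_ge0 => i _; rewrite mulr_ge0.
move=> u u0; rewrite horner_coef mulr_suml.
apply: le_trans (ler_norm_sum _ _ _) _; apply: ler_sum => i _.
rewrite normrM -mulrA ler_wpM2l// ger0_norm ?exprn_ge0//.
exact: exprn_le_expR.
Qed.

(** The functions p(1/t) exp(-1/t), extended by 0 to t <= 0, form a class stable under
    differentiation: [p] becomes X^2 (p - p'). *)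
Definition exp_inv p t := if 0 < t then p.[t^-1] * expR (- t^-1) else 0.

(** With u = 1/t the claim for t > 0 is u^2 |p(u)| <= C e^u. The square makes the difference
    quotient at 0 of order t, which gives differentiability there. *)
Lemma exp_inv_le_sqr p : exists2 C, 0 <= C & forall t, `|exp_inv p t| <= C * t ^+ 2.
Proof.
have [C C0 HC] := horner_le_expR (p * 'X^2).
exists C => // t; rewrite /exp_inv; case: ltP => t0; last first.
  by rewrite normr0 mulr_ge0// sqr_ge0.
have u0 : 0 <= t^-1 by rewrite invr_ge0 ltW.
have := HC _ u0; rewrite hornerM hornerXn normrM (ger0_norm (exprn_ge0 _ u0)) => H.
rewrite normrM (ger0_norm (expR_ge0 _)) expRN ler_pdivrMr ?expR_gt0//.
rewrite mulrAC -ler_pdivrMr ?exprn_gt0//.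
by apply: le_trans H; rewrite exprVn.
Qed.

Lemma is_derive_le_sqr (f : R -> R) (C : R) : f 0 = 0 ->
  (forall t, `|f t| <= C * t ^+ 2) -> is_derive (0 : R) (1 : R) f 0.
Proof.
move=> f0 fC.
have C0 : 0 <= C by have := le_trans (normr_ge0 _) (fC 1); rewrite expr1n mulr1.
have H : (fun h : R => h^-1 *: ((f \o shift 0) (h *: (1 : R)) - f 0)) @ 0^' --> (0 : R).
  apply/cvgr0Pnorm_le => e e0.
  have : \forall h \near 0^', `|h : R| <= e / (C + 1) /\ h != 0.
    near=> h; split; last by near: h; exact: nbhs_dnbhs_neq.
    near: h; apply: dnbhs0_le; rewrite divr_gt0//.
    by rewrite ltr_wpDl.
  apply: filterS => h [he h0] /=.
  rewrite f0 subr0 addr0 /GRing.scale /= mulr1 normrM normfV ler_pdivrMl ?normr_gt0//.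
  apply: (le_trans (fC h)); rewrite -(real_normK (num_real h)) expr2 mulrCA ler_wpM2l//.
  apply: (@le_trans _ _ (C * (e / (C + 1)))); first by rewrite ler_wpM2l.
  rewrite mulrCA; apply: ler_piMr; first exact: ltW.
  by rewrite ler_pdivrMr ?mul1r ?lerDl// ltr_wpDl.
split; first by apply/cvg_ex; exists 0.
exact: cvg_lim H.
Unshelve. all: by end_near. Qed.

Lemma is_derive_exp_inv p t :
  is_derive t (1 : R) (exp_inv p) (exp_inv ('X^2 * (p - p^`())) t).
Proof.
have [t0|t0|->] := ltgtP t 0.
- rewrite /exp_inv (lt_gtF t0).
  apply: (@near_eq_is_derive _ _ _ (cst 0)) => //.
  near=> s; rewrite lt_gtF//; near: s; exact: lt_nbhsl.
- have E : {near t, (fun s => p.[s^-1] * expR (- s^-1)) =1 exp_inv p}.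
    near=> s; rewrite /exp_inv ifT//; near: s; exact: lt_nbhsr.
  apply: (near_eq_is_derive E).
  have tN0 : t != 0 by rewrite gt_eqF.
  have dV : is_derive t (1 : R) (fun s : R => s^-1) (- t ^- 2).
    have dt : is_derive t (1 : R) (fun s : R => s) 1 by exact: is_derive_id.
    by have := is_deriveV tN0 dt; rewrite /GRing.scale /= mulr1.
  have dp := is_derive_comp1 dV (is_derive_poly p t^-1).
  have dN : is_derive t (1 : R) (fun s : R => - s^-1) (t ^- 2).
    by have := is_deriveN dV; rewrite opprK.
  have de := is_derive_comp1 dN (is_derive_expR (- t^-1)).
  apply: (is_derive_eq (is_deriveM dp de)).
  rewrite /exp_inv t0 /GRing.scale /= hornerM hornerXn hornerD hornerN exprVn; ring.
- have [C C0 HC] := exp_inv_le_sqr p.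
  rewrite {2}/exp_inv ltxx; apply: is_derive_le_sqr HC.
  by rewrite /exp_inv ltxx.
Unshelve. all: by end_near. Qed.

Definition bump t := exp_inv 1 t.

Lemma bumpE t : bump t = if 0 < t then expR (- t^-1) else 0.
Proof. by rewrite /bump /exp_inv hornerC mul1r. Qed.

Lemma bump_ge0 t : 0 <= bump t.
Proof. by rewrite bumpE; case: ifP => // _; exact: expR_ge0. Qed.

Lemma bump_gt0 t : (0 < bump t) = (0 < t).
Proof. by rewrite bumpE; case: ifP => // _; rewrite ?expR_gt0// ltxx. Qed.

Lemma bump_eq0 t : t <= 0 -> bump t = 0.
Proof. by rewrite bumpE leNgt => /negbTE ->. Qed.

Lemma bump_le1 t : bump t <= 1.
Proof. by rewrite bumpE; case: ifP => // t0; rewrite -expR0 ler_expR oppr_le0 invr_ge0 ltW. Qed.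

Lemma le_bump t1 t2 : t1 <= t2 -> bump t1 <= bump t2.
Proof.
move=> t12; have [t0|t0] := ltP 0 t1; last first.
  by rewrite [leLHS]bumpE ltNge t0 /= bump_ge0.
rewrite !bumpE t0 (lt_le_trans t0 t12) ler_expR lerN2 lef_pV2//.
by rewrite posrE (lt_le_trans t0 t12).
Qed.

Lemma cvg_bump t : 0 < t -> bump (n.+1%:R * t) @[n --> \oo] --> (1 : R).
Proof.
move=> t0.
have -> : (fun n => bump (n.+1%:R * t)) = (fun n => expR (- (t^-1 * n.+1%:R^-1))).
  by apply/funext => n; rewrite bumpE mulr_gt0// invfM mulrC.
have H : expR (- (t^-1 * n.+1%:R^-1)) @[n --> \oo] --> expR (- (t^-1 * 0)).
  apply: continuous_cvg; first exact: continuous_expR.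
  by apply: cvgN; apply: cvgM; [exact: cvg_cst|exact: cvg_harmonic].
by move: H; rewrite mulr0 oppr0 expR0.
Qed.

End bump.

Section box_bump.
Context {R : realType} {d : nat}.
Implicit Types (a b : 'I_d -> R) (x : 'rV[R]_d).

(** [c] is a steepness: as it grows, the product tends to 1 at each point of the open box, and for c
    > 0 it is 0 outside. *)
Definition box_bump (c : R) a b x :=
  \prod_(i < d) (bump (c * (x 0 i - a i)) * bump (c * (b i - x 0 i))).

Lemma smooth_bump_coord (c e : R) i : smooth (fun x => bump (c * x 0 i + e)).
Proof.
apply: (@smooth_coord R d (fun n => exp_inv (iter n (fun p => 'X^2 * (p - p^`())) 1))) => n t.
exact: is_derive_exp_inv.
Qed.

Lemma smooth_box_bump c a b : smooth (box_bump c a b).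
Proof.
apply: smooth_prod => i k; apply: is_CkM.
- by under eq_fun do rewrite mulrBr; exact: smooth_bump_coord.
- under eq_fun do rewrite mulrBr addrC -mulNr.
  exact: smooth_bump_coord.
Qed.

Lemma box_bump_ge0 c a b x : 0 <= box_bump c a b x.
Proof. by apply: prodr_ge0 => i _; rewrite mulr_ge0// bump_ge0. Qed.

Lemma box_bump_le1 c a b x : box_bump c a b x <= 1.
Proof.
apply: Num.Theory.prodr_ile1 => i _; rewrite mulr_ge0 ?bump_ge0//=.
by rewrite mulr_ile1 ?bump_ge0 ?bump_le1.
Qed.

Lemma box_bump_eq0 c a b x : 0 < c -> ~ (forall i, a i < x 0 i < b i) ->
  box_bump c a b x = 0.
Proof.
move=> c0 /existsNP[i /negP]; rewrite negb_and -!leNgt => Hi.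
rewrite /box_bump (bigD1 i)//=; case/orP : Hi => H.
- by rewrite (@bump_eq0 _ (c * (x 0 i - a i))) ?mul0r// pmulr_rle0// subr_le0.
- by rewrite (@bump_eq0 _ (c * (b i - x 0 i))) ?mulr0 ?mul0r// pmulr_rle0// subr_le0.
Qed.

Lemma cvg_prod n (F : 'I_n -> nat -> R) (l : 'I_n -> R) :
  (forall i, F i k @[k --> \oo] --> l i) ->
  \prod_(i < n) F i k @[k --> \oo] --> \prod_(i < n) l i.
Proof.
elim: n F l => [|n IH] F l Fl.
  by under eq_fun do rewrite big_ord0; rewrite big_ord0; exact: cvg_cst.
under eq_fun do rewrite big_ord_recl; rewrite big_ord_recl.
by apply: cvgM; [exact: Fl|exact: IH].
Qed.

Lemma cvg_bump_sub1 (t : R) : 0 < t -> bump (n.+1%:R * t - 1) @[n --> \oo] --> (1 : R).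
Proof.
move=> t0; have t20 : 0 < t / 2 by rewrite divr_gt0.
apply: (squeeze_cvgr _ (cvg_bump t20) (cvg_cst (1 : R))).
(* For (n+1) t >= 2 one has (n+1) t - 1 >= (n+1) t / 2, and [bump] is monotone. *)
near=> n; rewrite bump_le1 andbT; apply: le_bump.
have : 2 <= n.+1%:R * t.
  rewrite -ler_pdivrMr//; apply: (@le_trans _ _ n%:R); last by rewrite ler_nat.
  by near: n; exact: nbhs_infty_ger.
by rewrite mulrA; move: (n.+1%:R * t) => u; lra.
Unshelve. all: by end_near. Qed.

(* The supports are compact subsets of the open box. *)
Lemma cvg_inner_box_bump a b x :
  box_bump n.+1%:R (fun i => a i + n.+1%:R^-1) (fun i => b i - n.+1%:R^-1) x @[n --> \oo] -->
  (\1_[set x : 'rV[R]_d | forall i, a i < x 0 i < b i] x : R).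
Proof.
rewrite indicE; have [/set_mem /= xab|/negP xab] := boolP (x \in _); last first.
  rewrite (_ : (fun n : nat => _) = fun=> 0); first by rewrite mulr0n; exact: cvg_cst.
  apply/funext => n; apply: box_bump_eq0 => // H; apply: xab; rewrite mem_set//= => i.
  have := H i; have : 0 < n.+1%:R^-1 :> R by rewrite invr_gt0.
  by move: (n.+1%:R^-1) => e e0 /andP[? ?]; apply/andP; split; lra.
rewrite /= mulr1n -[X in _ --> X](@big1_eq _ 1 *%R _ (index_enum 'I_d) xpredT).
apply: cvg_prod => i; rewrite -[X in _ --> X](mulr1 1).
have /andP[ax xb] := xab i.
have E (n : nat) (t : R) : n.+1%:R * (t - n.+1%:R^-1) = n.+1%:R * t - 1.
  by rewrite mulrBr mulfV.
apply: cvgM.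
- under eq_fun do rewrite opprD addrA E.
  by apply: cvg_bump_sub1; rewrite subr_gt0.
- under eq_fun do rewrite addrAC E.
  by apply: cvg_bump_sub1; rewrite subr_gt0.
Qed.

End box_bump.

(** * Integration by parts against test functions *)

Section Rintegral_Rd.
Context {R : realType} {d : nat}.
Implicit Types f g : 'rV[R]_d -> R.

Definition L1 f := (lebesgue_Rd d).-integrable setT (EFin \o (f : borelRd R d -> R)).
Definition intRd f : R := \int[lebesgue_Rd d]_x f x.

Lemma intRd_EFin f : L1 f -> (\int[lebesgue_Rd d]_x (f x)%:E)%E = (intRd f)%:E.
Proof. by move=> f1; rewrite /intRd /Rintegral fineK// integrable_fin_num. Qed.

Lemma eq_intRd f g : (forall x, f x = g x) -> intRd f = intRd g.
Proof. by move=> fg; congr intRd; apply/funext. Qed.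

Lemma L1D f g : L1 f -> L1 g -> L1 (fun x => f x + g x).
Proof. by move=> f1 g1; exact: (integrableD measurableT f1 g1). Qed.

Lemma intRdD f g : L1 f -> L1 g -> intRd (fun x => f x + g x) = intRd f + intRd g.
Proof. by move=> f1 g1; exact: RintegralD. Qed.

Lemma L1Z (c : R) f : L1 f -> L1 (fun x => c * f x).
Proof. by move=> f1; exact: (integrableZl measurableT c f1). Qed.

Lemma intRdZ (c : R) f : L1 f -> intRd (fun x => c * f x) = c * intRd f.
Proof. by move=> f1; exact: RintegralZl. Qed.

Lemma L1_sum n (F : 'I_n -> 'rV[R]_d -> R) : (forall i, L1 (F i)) ->
  L1 (fun x => \sum_(i < n) F i x).
Proof.
move=> F1; rewrite /L1 (_ : _ \o _ = fun x => (\sum_(i < n) (F i x)%:E)%E).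
  apply: integrable_sum => // i _; exact: F1.
by apply/funext => x /=; rewrite sumEFin.
Qed.

Lemma intRd_sum n (F : 'I_n -> 'rV[R]_d -> R) : (forall i, L1 (F i)) ->
  intRd (fun x => \sum_(i < n) F i x) = \sum_(i < n) intRd (F i).
Proof.
elim: n F => [|n IH] F F1.
  rewrite big_ord0 (@eq_intRd _ (fun=> 0 * 0)) => [|x]; last by rewrite big_ord0 mulr0.
  by rewrite /intRd /Rintegral (eq_integral (fun=> 0%E)) ?integral0//= => x _; rewrite mul0r.
rewrite big_ord_recl -IH// -intRdD//; last exact: L1_sum.
by apply: eq_intRd => x; rewrite big_ord_recl.
Qed.

Lemma intRd_le f g : L1 f -> L1 g -> (forall x, f x <= g x) -> intRd f <= intRd g.
Proof. by move=> f1 g1 fg; apply: le_Rintegral. Qed.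

Lemma intRd_ge0 f : (forall x, 0 <= f x) -> 0 <= intRd f.
Proof. by move=> f0; apply: Rintegral_ge0. Qed.

Lemma Cc_L1 f : Cc f -> L1 f.
Proof. exact: Cc_integrable. Qed.

Lemma CcM f g : Cc f -> continuous g -> Cc (fun x => f x * g x).
Proof.
move=> [cf [M fM]] cg; split; first exact: continuous_mul.
by exists M => x /fM ->; rewrite mul0r.
Qed.

Lemma CcMr f g : Cc f -> continuous g -> Cc (fun x => g x * f x).
Proof.
move=> [cf [M fM]] cg; split; first exact: continuous_mul.
by exists M => x /fM ->; rewrite mulr0.
Qed.

Lemma Cc_norm f : Cc f -> Cc (fun x => `|f x|).
Proof.
move=> [cf [M fM]]; split; first exact: continuous_normr.
by exists M => x /fM ->; rewrite normr0.
Qed.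

Lemma intRd_by_parts i f f' g g' : Cc f -> (forall x, is_derive x (delta_mx 0 i) f (f' x)) ->
  continuous f' -> continuous g -> (forall x, is_derive x (delta_mx 0 i) g (g' x)) ->
  continuous g' -> intRd (fun x => g x * f' x) = - intRd (fun x => g' x * f x).
Proof.
move=> cf df cf' cg dg cg'; have ccf' := Cc_derive cf df cf'.
apply/eqP; rewrite -subr_eq0 opprK -intRdD; [|exact/Cc_L1/CcMr|exact/Cc_L1/CcMr].
pose h x := g x * f' x + g' x * f x.
have dh x : is_derive x (delta_mx 0 i) (fun y => g y * f y) (h x).
  apply: (is_derive_eq (is_deriveM (dg x) (df x))).
  by rewrite /h /GRing.scale /= (mulrC (g' x)).
have ch : continuous h by apply: continuous_add; apply: continuous_mul => //; case: cf.
have := integral_pderiv_compact (CcMr cf cg) dh ch.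
by rewrite /intRd /Rintegral => ->.
Qed.

Definition test f := smooth f /\ exists M, forall x, M < `|x| -> f x = 0.

Lemma test_Cc f : test f -> Cc f.
Proof. by move=> [/smooth_continuous]. Qed.

Lemma test_pderiv i f : test f -> test (pderiv i f).
Proof.
move=> [sf [M fM]]; split; first exact: smooth_pderiv.
exists M => x; apply: (derive_outside_support fM).
exact: (smooth_is_derive i x sf).
Qed.

Lemma test_sum n (F : 'I_n -> 'rV[R]_d -> R) : (forall i, test (F i)) ->
  test (fun x => \sum_(i < n) F i x).
Proof.
move=> tF; split; first by apply: smooth_sum => i; case: (tF i).
elim: n F tF => [|n IH] F tF.
  by exists 0 => x _; rewrite big_ord0.
have [|N HN] := IH (fun i => F (lift ord0 i)); first by move=> i; exact: tF.
have [_ [M FM]] := tF ord0.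
exists (Num.max M N) => x; rewrite gt_max => /andP[Mx Nx].
by rewrite big_ord_recl FM// HN// addr0.
Qed.

Lemma intRd_pderiv i f g g' : test f -> continuous g ->
  (forall x, is_derive x (delta_mx 0 i) g (g' x)) -> continuous g' ->
  intRd (fun x => g x * pderiv i f x) = - intRd (fun x => g' x * f x).
Proof.
move=> tf cg dg cg'; apply: intRd_by_parts => //; first exact: test_Cc.
  by move=> x; case: tf => sf _; exact: smooth_is_derive.
by have [] := test_Cc (test_pderiv i tf).
Qed.

End Rintegral_Rd.

Section sqdist.
Context {R : realType} {d : nat}.
Implicit Types (x y : 'rV[R]_d) (e p : R).

Definition sqd y x := \sum_(i < d) (x 0 i - y 0 i) ^+ 2.

Lemma sqd_ge0 y x : 0 <= sqd y x.
Proof. by apply: sumr_ge0 => i _; exact: sqr_ge0. Qed.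

Lemma sqr_coord_le_sqd y x i : (x 0 i - y 0 i) ^+ 2 <= sqd y x.
Proof.
by rewrite /sqd (bigD1 i)//= lerDl; apply: sumr_ge0 => j _; exact: sqr_ge0.
Qed.

Lemma sqd_eq0 y x : sqd y x = 0 -> x = y.
Proof.
move=> s0; apply/rowP => i; apply/eqP; rewrite -subr_eq0 -sqrf_eq0.
by rewrite eq_le sqr_ge0 andbT -s0 sqr_coord_le_sqd.
Qed.

Lemma sqdxx y : sqd y y = 0.
Proof. by apply: big1 => i _; rewrite subrr expr0n. Qed.

Lemma sqd_gt0 y x : x != y -> 0 < sqd y x.
Proof.
move=> xy; rewrite lt_neqAle sqd_ge0 andbT eq_sym; apply: contra xy => /eqP s0.
exact/eqP/sqd_eq0.
Qed.

Lemma sqdC y x : sqd y x = sqd x y.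
Proof. by apply: eq_bigr => i _; rewrite -sqrrN opprB. Qed.

Lemma continuous_coord_sub y i : continuous (fun x => x 0 i - y 0 i).
Proof. by apply: continuous_sub; [exact: coord_continuous|exact: cst_continuous]. Qed.

Lemma continuous_sqd y : continuous (sqd y).
Proof.
apply: continuous_sum => i; under eq_fun do rewrite expr2.
by apply: continuous_mul; exact: continuous_coord_sub.
Qed.

Lemma is_derive_coord_sub y x i j :
  is_derive x (delta_mx 0 i) (fun z : 'rV[R]_d => z 0 j - y 0 j) (j == i)%:R.
Proof.
have := is_derive_coord x (delta_mx 0 i) j; rewrite mxE eqxx /= => H.
by apply: is_derive_eq; rewrite subr0.
Qed.

Lemma is_derive_sqd y x i : is_derive x (delta_mx 0 i) (sqd y) (2 * (x 0 i - y 0 i)).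
Proof.
have H j : is_derive x (delta_mx 0 i) (fun z : 'rV[R]_d => (z 0 j - y 0 j) ^+ 2)
    ((x 0 j - y 0 j) * (j == i)%:R *+ 2).
  have H := is_derive_coord_sub y x i j.
  under eq_fun do rewrite expr2.
  by apply: (is_derive_eq (is_deriveM H H)); rewrite /GRing.scale /= mulr2n.
have := is_derive_sum H; rewrite (_ : \sum_(_ < _) _ = sqd y); last first.
  by apply/funext => z; rewrite fct_sumE.
move=> /is_derive_eq; apply.
rewrite (bigD1 i)//= eqxx mulr1 big1 ?addr0 ?mulr_natl// => j /negbTE ->.
by rewrite mulr0 mul0rn.
Qed.

(** The s + e of the overview: for e > 0 it is positive everywhere, so that its real powers and its
    logarithm are differentiable on the diagonal as well. *)
Definition rsqd e y x := sqd y x + e.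

Lemma rsqd_gt0 e y x : 0 < e -> 0 < rsqd e y x.
Proof. by move=> e0; rewrite /rsqd ltr_wpDl// sqd_ge0. Qed.

Lemma is_derive_rsqd e y x i : is_derive x (delta_mx 0 i) (rsqd e y) (2 * (x 0 i - y 0 i)).
Proof. by have H := is_derive_sqd y x i; rewrite /rsqd; apply: is_derive_eq; rewrite addr0. Qed.

Lemma continuous_rsqd e y : continuous (rsqd e y).
Proof. by apply: continuous_add; [exact: continuous_sqd|exact: cst_continuous]. Qed.

Lemma continuous_gt0_comp (g g' : R -> R) e y : 0 < e ->
  (forall t : R, 0 < t -> is_derive t (1 : R) g (g' t)) ->
  continuous (fun x => g (rsqd e y x)).
Proof.
move=> e0 dg x; apply: continuous_comp; first exact: continuous_rsqd.
apply/differentiable_continuous/derivable1_diffP.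
by case: (dg _ (rsqd_gt0 y x e0)).
Qed.

Lemma continuous_rsqd_powR e y p : 0 < e -> continuous (fun x => rsqd e y x `^ p).
Proof.
move=> e0; apply: (@continuous_gt0_comp (fun t => t `^ p) (fun t => p * t `^ (p - 1)) e y e0).
Qed.

Lemma is_derive_rsqd_powR e y p x i : 0 < e ->
  is_derive x (delta_mx 0 i) (fun z => rsqd e y z `^ p)
    (p * rsqd e y x `^ (p - 1) * (2 * (x 0 i - y 0 i))).
Proof.
move=> e0; have dp := @is_derive1_powR R p _ (rsqd_gt0 y x e0).
exact: (is_derive_comp1 (is_derive_rsqd e y x i) dp).
Qed.

Lemma norm_coord_sub_le e y x i : 0 < e -> `|x 0 i - y 0 i| <= rsqd e y x `^ (2^-1).
Proof.
move=> e0; rewrite powR12_sqrt ?(ltW (rsqd_gt0 _ _ _))// -sqrtr_sqr ler_wsqrtr//.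
by apply: (le_trans (sqr_coord_le_sqd y x i)); rewrite lerDl ltW.
Qed.

End sqdist.

(** * Local integrability of the singular kernels *)

Section local_integrability.
Context {R : realType} {d : nat}.
Implicit Types (x y : 'rV[R]_d) (f : 'rV[R]_d -> R).

Lemma powR_addr (t r s : R) : 0 < t -> t `^ (r + s) = t `^ r * t `^ s.
Proof. by move=> t0; rewrite powRD//; apply/implyP => _; rewrite gt_eqF. Qed.

Lemma powR_pred (t p : R) : 0 < t -> t * t `^ (p - 1) = t `^ p.
Proof. by move=> t0; rewrite -{1}(powRr1 (ltW t0)) -powR_addr// addrC subrK. Qed.

Lemma le0_powR (t1 t2 p : R) : p <= 0 -> 0 < t1 -> t1 <= t2 -> t2 `^ p <= t1 `^ p.
Proof.
move=> p0 t10 t12; have t20 := lt_le_trans t10 t12.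
have q0 : 0 <= - p by rewrite oppr_ge0.
rewrite -(opprK p); move: (- p) q0 => q q0; rewrite !powRN lef_pV2 ?posrE ?powR_gt0//.
by apply: ge0_ler_powR; rewrite ?nnegrE// ltW.
Qed.

Lemma test_box_bump (c : R) (a b : 'I_d -> R) : 0 < c -> test (box_bump c a b).
Proof.
move=> c0; split; first exact: smooth_box_bump.
exists (\sum_(i < d) (`|a i| + `|b i|)) => x Mx; apply: box_bump_eq0 => // H.
move: Mx; apply/negP; rewrite -leNgt; apply: norm_le_coord.
  by apply: sumr_ge0 => i _; rewrite addr_ge0.
move=> i; rewrite (bigD1 i)//= -[leLHS]addr0 lerD//; last first.
  by apply: sumr_ge0 => j _; rewrite addr_ge0.
have /andP[ax xb] := H i; rewrite ler_norml; apply/andP; split.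
  apply: le_trans (ltW ax); rewrite lerNl.
  by apply: (le_trans (ler_norm _)); rewrite normrN lerDl.
by rewrite (le_trans (ltW xb))// (le_trans (ler_norm _))// lerDr.
Qed.

(** [|f|] cannot be differentiated, so integrations by parts are made against a smooth majorant. *)
Lemma Cc_le_test f : Cc f -> exists (C : R) (chi : 'rV[R]_d -> R),
  [/\ 0 <= C, test chi, forall x, 0 <= chi x & forall x, `|f x| <= C * chi x].
Proof.
move=> cf; have [K [K0 fK]] := Cc_bounded cf; have [_ [M fM]] := cf.
(* Where |x| <= M, both arguments of [bump] in each coordinate are at least 1 by the choice of [N],
   so the box bump is at least [delta]. *)
pose N := Num.max M 0 + 1; pose delta : R := bump 1 ^+ 2 ^+ d.
have b1 : 0 < bump (1 : R) by rewrite bump_gt0.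
have delta0 : 0 < delta by rewrite !exprn_gt0.
exists (K / delta), (box_bump 1 (fun=> - N) (fun=> N)); split.
- by rewrite divr_ge0// ltW.
- exact: test_box_bump.
- by move=> x; exact: box_bump_ge0.
move=> x; have [Mx|Mx] := ltP M `|x|.
  by rewrite fM// normr0 mulr_ge0 ?box_bump_ge0// divr_ge0// ltW.
rewrite mulrAC ler_pdivlMr// ler_pM// ?(ltW delta0)//.
rewrite /delta -[X in _ ^+ X]card_ord -prodr_const; apply: ler_prod => i _.
rewrite sqr_ge0/= expr2.
have : `|x 0 i| <= N - 1.
  by rewrite addrK le_max (le_trans (coord_le_norm x i) Mx).
rewrite ler_norml => /andP[x1 x2].
apply: ler_pM; rewrite ?bump_ge0//; apply: le_bump; lra.
Qed.

(** With q = s + e and p = -(a+1)/2, the divergence of (x - y) q^p is d q^p + 2 p s q^(p-1) >= (d +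
    2p) q^p, because p <= 0 and s <= q; and d + 2p = d - a - 1 > 0. Integrating by parts moves the
    derivative to the test function and leaves |x_i - y_i| q^p <= q^(-a/2), the previous
    exponent. *)
Lemma rsqd_integral_bound (a : nat) : (a < d)%N -> forall f, Cc f ->
  exists C, forall y e, 0 < e ->
    intRd (fun x => `|f x| * rsqd e y x `^ (- (a%:R / 2))) <= C.
Proof.
elim: a => [|a IH] ad f cf.
  exists (intRd (fun x => `|f x|)) => y e e0; rewrite mul0r oppr0.
  by under eq_intRd do rewrite powRr0 mulr1.
have [K [chi [K0 tchi chi0 fchi]]] := Cc_le_test cf.
have cchi := test_Cc tchi.
have /choice[C HC] : forall i : 'I_d, exists C, forall y e, 0 < e ->
    intRd (fun x => `|pderiv i chi x| * rsqd e y x `^ (- (a%:R / 2))) <= C.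
  by move=> i; apply: IH (ltnW ad) _ (test_Cc (test_pderiv i tchi)).
set p : R := - (a.+1%:R / 2).
have p0 : p <= 0 by rewrite oppr_le0 divr_ge0.
have dp : 0 < d%:R + 2 * p :> R.
  by rewrite /p mulrN mulrCA divff// mulr1 subr_gt0 ltr_nat.
exists (K * ((d%:R + 2 * p)^-1 * \sum_(i < d) C i)) => y e e0.
have q0 x := rsqd_gt0 y x e0.
have cq r : continuous (fun x => rsqd e y x `^ r) by exact: continuous_rsqd_powR.
have L g r : Cc g -> L1 (fun x => g x * rsqd e y x `^ r).
  by move=> cg; exact/Cc_L1/CcM.
apply: (@le_trans _ _ (K * intRd (fun x => chi x * rsqd e y x `^ p))).
  rewrite -intRdZ; last exact: L.
  apply: intRd_le; [exact/L/Cc_norm|exact/L1Z/L|move=> x].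
  by rewrite mulrA ler_wpM2r// powR_ge0.
apply: ler_wpM2l => //; rewrite ler_pdivlMl//.
pose g i x := (x 0 i - y 0 i) * rsqd e y x `^ p.
pose g' i x := (x 0 i - y 0 i) * (p * rsqd e y x `^ (p - 1) * (2 * (x 0 i - y 0 i)))
  + rsqd e y x `^ p.
have dg i x : is_derive x (delta_mx 0 i) (g i) (g' i x).
  have H := is_derive_coord_sub y x i i; rewrite eqxx in H.
  apply: (is_derive_eq (is_deriveM H (is_derive_rsqd_powR y p x i e0))).
  by rewrite /g' /GRing.scale /= mulr1.
have cg i : continuous (g i).
  by apply: continuous_mul => //; exact: continuous_coord_sub.
have cg' i : continuous (g' i).
  apply: continuous_add => //; apply: continuous_mul; first exact: continuous_coord_sub.
  apply: continuous_mul.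
    by apply: continuous_mul => //; exact: cst_continuous.
  by apply: continuous_mul; [exact: cst_continuous|exact: continuous_coord_sub].
have ibp i := intRd_pderiv tchi (cg i) (dg i) (cg' i).
have sumg' x : (d%:R + 2 * p) * rsqd e y x `^ p <= \sum_(i < d) g' i x.
  rewrite big_split/= sumr_const card_ord.
  under eq_bigr do rewrite mulrC -!mulrA -expr2.
  rewrite -mulr_sumr -mulr_sumr -mulr_sumr -/(sqd y x) mulrDl [leRHS]addrC.
  rewrite -[X in _ <= X + _]mulr_natl lerD2l.
  rewrite -(powR_pred p (q0 x)) (mulrC 2) -!mulrA ler_wnM2l//.
  rewrite [leLHS]mulrCA ler_pM2l// [leLHS]mulrC ler_wpM2r ?powR_ge0//.
  by rewrite /rsqd lerDl ltW.
apply: (@le_trans _ _ (intRd (fun x => \sum_(i < d) g' i x * chi x))).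
  rewrite -intRdZ; last exact: L.
  apply: intRd_le; [exact/L1Z/L|by apply: L1_sum => i; exact/Cc_L1/CcMr|move=> x].
  rewrite -mulr_suml mulrCA [leRHS]mulrC ler_wpM2l//.
rewrite intRd_sum; last by move=> i; exact/Cc_L1/CcMr.
apply: ler_sum => i _; apply: le_trans (HC i y e e0).
rewrite -[leLHS]opprK -ibp -mulN1r -intRdZ; last first.
  exact/Cc_L1/CcMr/cg/test_Cc/test_pderiv.
apply: intRd_le.
- by apply/L1Z/Cc_L1/CcMr => //; exact/test_Cc/test_pderiv.
- exact/L/Cc_norm/test_Cc/test_pderiv.
- move=> x; rewrite mulN1r (le_trans (ler_norm _))// normrN normrM mulrC.
  rewrite ler_wpM2l// /g normrM (ger0_norm (powR_ge0 _ _)).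
  apply: (@le_trans _ _ (rsqd e y x `^ 2^-1 * rsqd e y x `^ p)).
    by rewrite ler_wpM2r ?powR_ge0// norm_coord_sub_le.
  have E : 2^-1 + p = - (a%:R / 2) by rewrite /p -natr1; field.
  by rewrite -powR_addr// E.
Qed.

End local_integrability.

(** Fatou's lemma as a bound that passes to the limit. The alternative [f x = 0] is for a singular
    point where the approximations blow up but the limit has the default value 0. *)
Lemma fatou_cvg (R : realType) (disp : measure_display) (T : measurableType disp)
    (mu : {measure set T -> \bar R}) (F : nat -> T -> R) (f : T -> R) (C : R) :
  (forall n, measurable_fun setT (F n)) -> measurable_fun setT f ->
  (forall n x, 0 <= F n x) -> (forall x, 0 <= f x) ->
  (forall x, f x = 0 \/ F n x @[n --> \oo] --> f x) ->
  (forall n, (\int[mu]_x (F n x)%:E <= C%:E)%E) ->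
  (\int[mu]_x (f x)%:E <= C%:E)%E.
Proof.
move=> mF mf F0 f0 Ff FC.
have mFE n : measurable_fun setT (fun x => (F n x)%:E) by exact/measurable_EFinP.
apply: (@le_trans _ _ (\int[mu]_x limn_einf (fun n => (F n x)%:E))%E).
  apply: ge0_le_integral => //.
  - by move=> x _; rewrite lee_fin.
  - exact/measurable_EFinP.
  - apply: measurableT_comp => //; apply: measurable_fun_limn_esup => n.
    by apply: measurableT_comp.
  - move=> x _; have [->|H] := Ff x.
      rewrite limn_einf_lim; apply: lime_ge; first exact: is_cvg_einfs.
      by apply: nearW => n; apply: le_ereal_inf_tmp => _ [k _ <-]; rewrite lee_fin.
    have HE : (F n x)%:E @[n --> \oo] --> (f x)%:E.
      by apply: cvg_EFin => //; apply: nearW.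
    by rewrite is_cvg_limn_einfE; [rewrite (cvg_lim _ HE)|apply/cvg_ex; eexists; exact: HE].
apply: le_trans (fatou _ measurableT mFE _) _ => [n x _|]; first by rewrite lee_fin.
rewrite limn_einf_lim; apply: lime_le; first exact: is_cvg_einfs.
apply: nearW => n; apply: le_trans (FC n); apply: ereal_inf_lbound.
by exists n => /=.
Qed.

(** * Removing the regularization *)

Section dominated.
Context {R : realType} {d : nat}.
Implicit Types (x y : 'rV[R]_d) (f : 'rV[R]_d -> R).

(** A square, so that its root 1/(n+1) is the dilation factor in [intRd_kern_scale]. *)
Definition eps n : R := (n.+1%:R^-1) ^+ 2.

Lemma eps_gt0 n : 0 < eps n. Proof. by rewrite exprn_gt0// invr_gt0. Qed.

Lemma eps_le1 n : eps n <= 1.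
Proof. by rewrite exprn_ile1 ?invr_ge0// invf_le1// ler1n. Qed.

Lemma cvg_eps : eps n @[n --> \oo] --> 0.
Proof.
have -> : 0 = 0 * 0 :> R by rewrite mulr0.
under eq_fun do rewrite /eps expr2.
by apply: cvgM; exact: cvg_harmonic.
Qed.

Lemma cvg_gt0_eps (g : R -> R) (l s : R) : 0 < s -> is_derive s (1 : R) g l ->
  g (s + eps n) @[n --> \oo] --> g s.
Proof.
move=> s0 dg; have cg : {for s, continuous g}.
  by apply/differentiable_continuous/derivable1_diffP; case: dg.
apply: continuous_cvg => //; rewrite -[X in _ --> X]addr0.
by apply: cvgD; [exact: cvg_cst|exact: cvg_eps].
Qed.

Lemma measurable_sqd_comp (g : R -> R) y : measurable_fun setT g ->
  measurable_fun setT (fun x : borelRd R d => g (sqd y x)).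
Proof.
move=> mg; apply: measurableT_comp => //.
by apply: continuous_measurable_rV; exact: continuous_sqd.
Qed.

Lemma measurable_norm_sqd_powR f y p : continuous f ->
  measurable_fun setT (fun x : borelRd R d => `|f x| * sqd y x `^ p).
Proof.
move=> cf; apply: measurable_funM.
  by apply: continuous_measurable_rV; exact: continuous_normr.
by apply: (@measurable_sqd_comp (fun t => t `^ p)); exact: measurable_powR.
Qed.

(** Fatou as e tends to 0. Uniformity in [y] survives, and is what the integration against a measure
    in [y] needs. *)
Lemma sqd_integral_bound (a : nat) : (a < d)%N -> forall f, Cc f ->
  exists2 C, 0 <= C & forall y,
    (\int[lebesgue_Rd d]_x (`|f x| * sqd y x `^ (- (a%:R / 2)))%:E <= C%:E)%E.
Proof.
move=> ad f cf; have [C HC] := rsqd_integral_bound ad cf.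
have C0 : 0 <= C.
  apply: le_trans (HC 0 1 ltr01); apply: intRd_ge0 => x.
  by rewrite mulr_ge0// powR_ge0.
exists C => // y; set p := - _.
pose F n x := `|f x| * rsqd (eps n) y x `^ p.
have CF n : Cc (F n).
  apply: CcM; first exact: Cc_norm.
  exact/continuous_rsqd_powR/eps_gt0.
have F0 n x : 0 <= F n x by rewrite mulr_ge0// powR_ge0.
apply: (@fatou_cvg R _ (borelRd R d) (lebesgue_Rd d) F (fun x => `|f x| * sqd y x `^ p) C).
- by move=> n; apply: continuous_measurable_rV; case: (CF n).
- by apply: measurable_norm_sqd_powR; case: cf.
- exact: F0.
- by move=> x; rewrite mulr_ge0// powR_ge0.
- move=> x; have [->|xy] := eqVneq x y.
    (* The power of 0 is 0 by convention when the exponent is not 0, while the regularized powers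
       blow up. *)
    rewrite sqdxx; have [p0|p0] := eqVneq p 0; last by left; rewrite powR0// mulr0.
    right; rewrite p0 powRr0 mulr1.
    by under eq_fun do rewrite /F p0 powRr0 mulr1; exact: cvg_cst.
  right; have s0 := sqd_gt0 xy.
  apply: cvgM; first exact: cvg_cst.
  exact: (cvg_gt0_eps s0 (@is_derive1_powR R p _ s0)).
- move=> n; rewrite (intRd_EFin (Cc_L1 (CF n))) lee_fin; exact/HC/eps_gt0.
Qed.

Lemma L1_sqd_powR (a : nat) y f : (a < d)%N -> Cc f ->
  L1 (fun x => `|f x| * sqd y x `^ (- (a%:R / 2))).
Proof.
move=> ad cf; have [C C0 HC] := sqd_integral_bound ad cf.
apply/integrableP; split.
  by apply/measurable_EFinP; apply: measurable_norm_sqd_powR; case: cf.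
apply: (@le_lt_trans _ _ C%:E); last exact: ltry.
apply: le_trans (HC y); rewrite le_eqVlt; apply/orP; left; apply/eqP.
by apply: eq_integral => x _ /=; rewrite ger0_norm// mulr_ge0// powR_ge0.
Qed.

End dominated.

Section weight.
Context {R : realType}.

(* The local singularities [s `^ (- (d.-1%:R / 2))], where [s] is a squared
   distance, are the strongest for which the induction of
   [rsqd_integral_bound] yields integrability. *)
Definition weight (d : nat) (s : R) := 1 + s + s `^ (- (d.-1%:R / 2)).

Lemma weight_ge1 d s : 0 <= s -> 1 <= weight d s.
Proof. by move=> s0; rewrite /weight -addrA lerDl addr_ge0// powR_ge0. Qed.

End weight.

Section dominated_sqd.
Context {R : realType} {d : nat}.
Hypothesis d0 : (0 < d)%N.
Implicit Types (x y : 'rV[R]_d) (f : 'rV[R]_d -> R).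

Lemma ae_neq (y : 'rV[R]_d) (P : 'rV[R]_d -> Prop) : (forall x, x != y -> P x) ->
  {ae lebesgue_Rd d, forall x : borelRd R d, P x}.
Proof.
move=> H; exists [set y]; split.
- apply: measurable_closed_rV; exact/accessible_closed_set1/hausdorff_accessible/norm_hausdorff.
- by case: d d0 y {P H} => [//|n] _ y; exact: lebesgue_Rd_set1.
- by move=> x /= nP; apply/eqP; apply: contra_notT nP => /H.
Qed.

Lemma L1_weight y f : Cc f -> L1 (fun x => `|f x| * weight d (sqd y x)).
Proof.
move=> cf.
have -> : (fun x => `|f x| * weight d (sqd y x)) = (fun x => `|f x| * (1 + sqd y x) +
    `|f x| * sqd y x `^ (- (d.-1%:R / 2))) by apply/funext => x; rewrite -mulrDr.
apply: L1D; last by apply: L1_sqd_powR => //; rewrite prednK.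
apply: Cc_L1; apply: CcM; first exact: Cc_norm.
by apply: continuous_add; [exact: cst_continuous|exact: continuous_sqd].
Qed.

(** Dominated convergence with a multiple of [|f|] times [weight] as majorant. Bounds and limits are
    asked only for s > 0, since the point x = y is negligible. *)
Lemma intRd_cvg_sqd (Psi : nat -> R -> R) (psi : R -> R) (C : R) f y : Cc f ->
  (forall n, measurable_fun setT (Psi n)) -> measurable_fun setT psi ->
  (forall s, 0 < s -> Psi n s @[n --> \oo] --> psi s) ->
  (forall n s, 0 < s -> `|Psi n s| <= C * weight d s) ->
  L1 (fun x => psi (sqd y x) * f x) /\
  intRd (fun x => Psi n (sqd y x) * f x) @[n --> \oo] --> intRd (fun x => psi (sqd y x) * f x).
Proof.
move=> cf mPsi mpsi cvgPsi Psi_le.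
have mf : measurable_fun setT (f : borelRd R d -> R).
  by apply: continuous_measurable_rV; case: cf.
have mP (g : R -> R) : measurable_fun setT g ->
    measurable_fun setT (fun x : borelRd R d => (g (sqd y x) * f x)%:E).
  move=> mg; apply/measurable_EFinP; apply: measurable_funM => //.
  exact: measurable_sqd_comp.
have iW := L1Z C (L1_weight y cf).
have [] := @dominated_convergence _ _ _ (lebesgue_Rd d) setT measurableT
  (fun n x => (Psi n (sqd y x) * f x)%:E) (fun x => (psi (sqd y x) * f x)%:E)
  (fun x => (C * (`|f x| * weight d (sqd y x)))%:E) (fun n => mP _ (mPsi n)) (mP _ mpsi) _ iW _.
- apply: (@ae_neq y) => x /sqd_gt0 s0 _; apply: cvg_EFin; first exact: nearW.
  by apply: cvgM; [exact: cvgPsi|exact: cvg_cst].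
- apply: (@ae_neq y) => x /sqd_gt0 s0 n _; rewrite /= lee_fin normrM mulrC mulrCA.
  by rewrite ler_wpM2l// Psi_le.
move=> L1psi _ cvI; split => //.
by apply: fine_cvg; rewrite /intRd /Rintegral fineK//; exact: integrable_fin_num.
Qed.

End dominated_sqd.

(** * Laplacians of radial kernels *)

Section laplacian.
Context {R : realType} {d : nat}.
Hypothesis d0 : (0 < d)%N.
Implicit Types (x y : 'rV[R]_d) (f chi : 'rV[R]_d -> R).

Definition laplacian f x := \sum_(i < d) pderiv i (pderiv i f) x.

Lemma test_laplacian f : test f -> test (laplacian f).
Proof. by move=> tf; apply: test_sum => i; do 2 apply: test_pderiv. Qed.

(** Only the derivative of [Phi] is prescribed, so that powers (k = p) and the logarithm (p = 0) are
    treated together. With q = s + e, the gradient is 2 k (x - y) q^(p-1) and its divergence 2 k (d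
    q^(p-1) + 2 (p-1) s q^(p-2)); replacing s by q - e isolates the term in e. *)
Lemma intRd_rsqd_laplacian (Phi : R -> R) (k p : R) chi y e : 0 < e ->
  (forall t : R, 0 < t -> is_derive t (1 : R) Phi (k * t `^ (p - 1))) -> test chi ->
  intRd (fun x => Phi (rsqd e y x) * laplacian chi x) =
  intRd (fun x => (2 * k * (d%:R + 2 * p - 2) * rsqd e y x `^ (p - 1) -
     4 * k * (p - 1) * (e * rsqd e y x `^ (p - 1 - 1))) * chi x).
Proof.
move=> e0 dPhi tchi.
have cq r : continuous (fun x => rsqd e y x `^ r) by exact: continuous_rsqd_powR.
have q0 x := rsqd_gt0 y x e0.
have cPhi : continuous (fun x => Phi (rsqd e y x)) by exact: (@continuous_gt0_comp _ _ Phi (fun t => k * t `^ (p - 1))).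
pose g i x := 2 * k * ((x 0 i - y 0 i) * rsqd e y x `^ (p - 1)).
pose g' i x := 2 * k * (rsqd e y x `^ (p - 1) +
  (x 0 i - y 0 i) * ((p - 1) * rsqd e y x `^ (p - 1 - 1) * (2 * (x 0 i - y 0 i)))).
have dP i x : is_derive x (delta_mx 0 i) (fun z => Phi (rsqd e y z)) (g i x).
  apply: (is_derive_eq (is_derive_comp1 (is_derive_rsqd e y x i) (dPhi _ (q0 x)))).
  rewrite /g; ring.
have dg i x : is_derive x (delta_mx 0 i) (g i) (g' i x).
  have H := is_derive_coord_sub y x i i; rewrite eqxx in H.
  have H2 := is_deriveM H (is_derive_rsqd_powR y (p - 1) x i e0).
  apply: (is_derive_eq (is_deriveZ (2 * k) H2)).
  by rewrite /g' /GRing.scale /= mulr1 addrC.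
have cg i : continuous (g i).
  apply: continuous_mul; first exact: cst_continuous.
  by apply: continuous_mul => //; exact: continuous_coord_sub.
have cg' i : continuous (g' i).
  apply: continuous_mul; first exact: cst_continuous.
  apply: continuous_add => //; apply: continuous_mul; first exact: continuous_coord_sub.
  apply: continuous_mul.
    by apply: continuous_mul => //; exact: cst_continuous.
  by apply: continuous_mul; [exact: cst_continuous|exact: continuous_coord_sub].
have cpp i : Cc (pderiv i (pderiv i chi)) by apply: test_Cc; do 2 apply: test_pderiv.
under eq_intRd do rewrite mulr_sumr.
rewrite intRd_sum; last by move=> i; exact/Cc_L1/CcMr.
have E i : intRd (fun x => Phi (rsqd e y x) * pderiv i (pderiv i chi) x) = intRd (fun x => g' i x * chi x).
  rewrite (intRd_pderiv (test_pderiv i tchi) cPhi (dP i) (cg i)).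
  by rewrite (intRd_pderiv tchi (cg i) (dg i) (cg' i)) opprK.
under eq_bigr do rewrite E.
rewrite -intRd_sum; last by move=> i; exact/Cc_L1/CcMr/cg'/test_Cc.
apply: eq_intRd => x; rewrite -mulr_suml; congr (_ * _).
rewrite -mulr_sumr big_split/= sumr_const card_ord.
under eq_bigr do rewrite mulrC -!mulrA -expr2.
rewrite -mulr_sumr -mulr_sumr -mulr_sumr -/(sqd y x).
rewrite -[sqd y x](addrK e) -/(rsqd e y x) -mulr_natl -(powR_pred (p - 1) (q0 x)).
ring.
Qed.

End laplacian.

(** * The approximate identity and the fundamental solution *)

Section fundamental_solution.
Context {R : realType} {d : nat}.
Hypothesis d0 : (0 < d)%N.
Implicit Types (x y z : 'rV[R]_d) (f chi : 'rV[R]_d -> R).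

Definition kern z : R := rsqd 1 0 z `^ (- (d%:R / 2) - 1).

Lemma continuous_kern : continuous kern.
Proof. exact: continuous_rsqd_powR. Qed.

Lemma kern_gt0 z : 0 < kern z.
Proof. by rewrite powR_gt0// rsqd_gt0. Qed.

Lemma rsqd_scale (t : R) y z : rsqd (t ^+ 2) y (t *: z + y) = t ^+ 2 * rsqd 1 0 z.
Proof.
rewrite /rsqd mulrDr mulr1 /sqd mulr_sumr; congr (_ + _).
by apply: eq_bigr => i _; rewrite scaleD_mxE addrK mxE subr0 exprMn.
Qed.

Lemma cvg_scale_add f z y : continuous f -> f (n.+1%:R^-1 *: z + y) @[n --> \oo] --> f y.
Proof.
move=> cf; have cA : continuous (fun t : R => t *: z + y).
  apply: continuous_rV => i; under eq_fun do rewrite scaleD_mxE.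
  apply: continuous_add; last exact: cst_continuous.
  by apply: continuous_mul; [move=> t; exact: cvg_id|exact: cst_continuous].
have cfA : {for 0, continuous (fun t : R => f (t *: z + y))}.
  by apply: continuous_comp; [exact: cA|exact: cf].
have := @cvg_harmonic R => /(continuous_cvg _ cfA).
by rewrite scale0r add0r.
Qed.

(** Under x = t z + y, the Jacobian t^d, the factor t^2 and the power (t^2)^(-d/2-1) cancel. *)
Lemma intRd_kern_scale f y (t : R) : 0 < t -> Cc f ->
  intRd (fun x => (t ^+ 2 * rsqd (t ^+ 2) y x `^ (- (d%:R / 2) - 1)) * f x) =
  intRd (fun z => kern z * f (t *: z + y)).
Proof.
move=> t0 cf; have t20 : 0 < t ^+ 2 by rewrite exprn_gt0.
pose F x := (t ^+ 2 * rsqd (t ^+ 2) y x `^ (- (d%:R / 2) - 1)) * f x.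
have cF : Cc F.
  apply: CcMr => //; apply: continuous_mul; first exact: cst_continuous.
  exact: continuous_rsqd_powR.
have := integral_affine y t0 cF.
rewrite (intRd_EFin (Cc_L1 cF)) (intRd_EFin (Cc_L1 (Cc_affine y t0 cF))) -EFinM => -[->].
rewrite -intRdZ; last exact/Cc_L1/Cc_affine.
apply: eq_intRd => z; rewrite /F mulrA; congr (_ * _).
rewrite rsqd_scale powRM ?(ltW t20) ?(ltW (rsqd_gt0 _ _ _))// -/(kern z).
have td : t ^+ d = (t ^+ 2) `^ (d%:R / 2).
  by rewrite -(powR_mulrn 2 (ltW t0)) -powRrM mulrCA divff// mulr1 powR_mulrn// ltW.
rewrite td; move: (t ^+ 2) t20 => u u0; rewrite mulrA mulrA -[RHS]mul1r; congr (_ * _).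
rewrite -{2}(powRr1 (ltW u0)) -!powR_addr//.
have -> : d%:R / 2 + 1 + (- (d%:R / 2) - 1) = 0 :> R by ring.
by rewrite powRr0.
Qed.

Lemma le_weight (s e : R) : 0 < s -> 0 < e -> e <= 1 -> weight d (s + e) <= 2 * weight d s.
Proof.
move=> s0 e0 e1; rewrite /weight.
have : (s + e) `^ (- (d.-1%:R / 2)) <= s `^ (- (d.-1%:R / 2)).
  by apply: le0_powR; rewrite ?oppr_le0 ?divr_ge0 ?lerDl// ltW.
have := powR_ge0 s (- (d.-1%:R / 2)); lra.
Qed.

Variables (Phi Phi' : R -> R) (C : R).
Hypotheses (dPhi : forall t : R, 0 < t -> is_derive t (1 : R) Phi (Phi' t))
  (mPhi : measurable_fun setT Phi)
  (Phi_le : forall t, 0 < t -> `|Phi t| <= C * weight d t).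

Lemma intRd_cvg_rsqd f y : Cc f ->
  L1 (fun x => Phi (sqd y x) * f x) /\
  intRd (fun x => Phi (rsqd (eps n) y x) * f x) @[n --> \oo] --> intRd (fun x => Phi (sqd y x) * f x).
Proof.
move=> cf.
have C0 : 0 <= C.
  have := le_trans (normr_ge0 _) (Phi_le ltr01).
  by rewrite pmulr_lge0// (lt_le_trans _ (weight_ge1 d ler01)).
apply: (@intRd_cvg_sqd _ _ d0 (fun n s => Phi (s + eps n)) Phi (C * 2)) => //.
- move=> n; apply: (measurableT_comp mPhi); exact: measurable_funD.
- by move=> s s0; exact: cvg_gt0_eps (dPhi s0).
- move=> n s s0; apply: le_trans (Phi_le (addr_gt0 s0 (eps_gt0 n))) _.
  by rewrite -mulrA ler_wpM2l// le_weight// ?eps_gt0 ?eps_le1.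
Qed.

End fundamental_solution.

Section fundamental_solution_identity.
Context {R : realType} {d : nat}.
Hypothesis d0 : (0 < d)%N.
Implicit Types (x y z : 'rV[R]_d) (f chi : 'rV[R]_d -> R).
Variables (Phi : R -> R) (k C : R).
Hypotheses (dPhi : forall t : R, 0 < t -> is_derive t (1 : R) Phi (k * t `^ (- (d%:R / 2))))
  (mPhi : measurable_fun setT Phi)
  (Phi_le : forall t, 0 < t -> `|Phi t| <= C * weight d t) (k0 : k != 0).

(** At p = 1 - d/2 the coefficient d + 2p - 2 vanishes and only the term in e remains, with constant
    -4 k (p-1) = 2 k d. The limit is expressed through [Phi], at a stage where [kern] is not yet
    known to be integrable. *)
Lemma cvg_intRd_kern chi y : test chi ->
  2 * k * d%:R * intRd (fun z => kern z * chi (n.+1%:R^-1 *: z + y)) @[n --> \oo] -->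
  intRd (fun x => Phi (sqd y x) * laplacian chi x).
Proof.
move=> tchi; have tL := test_laplacian tchi.
have [_] := intRd_cvg_rsqd d0 dPhi mPhi Phi_le y (test_Cc tL).
rewrite (_ : (fun n => intRd _) = (fun n => 2 * k * d%:R *
  intRd (fun z => kern z * chi (n.+1%:R^-1 *: z + y))))//.
apply/funext => n; have e0 := @eps_gt0 R n; set p : R := 1 - d%:R / 2.
have dPhip (t : R) : 0 < t -> is_derive t (1 : R) Phi (k * t `^ (p - 1)).
  by move=> t0; rewrite /p addrAC subrr add0r; exact: dPhi.
rewrite (intRd_rsqd_laplacian y e0 dPhip tchi).
rewrite -intRd_kern_scale ?invr_gt0//; last exact: test_Cc.
rewrite -intRdZ; last first.
  apply/Cc_L1/CcMr; first exact: test_Cc.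
  apply: continuous_mul; first exact: cst_continuous.
  exact: continuous_rsqd_powR.
apply: eq_intRd => x; rewrite mulrA; congr (_ * _).
have -> : p - 1 = - (d%:R / 2) by rewrite /p; ring.
by rewrite -/(eps n) /p; field.
Qed.

(** The integrals of [kern] against dilates of a nonnegative bump converge by [cvg_intRd_kern],
    hence are bounded, and Fatou concludes since the dilates tend to the constant [chi 0 > 0].
    Integrability is thus deduced from the properties of [Phi], which the statement does not
    mention, rather than from the decay at infinity. *)
Lemma L1_kern : L1 (@kern R d).
Proof.
pose chi := box_bump 1 (fun _ : 'I_d => (-1 : R)) (fun=> 1).
have tchi : test chi by apply: test_box_bump.
have cchi := test_Cc tchi.
have v0 : 0 < chi 0.
  by apply: prodr_gt0 => i _; rewrite mxE !mul1r mulr_gt0// bump_gt0; lra.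
pose F n z := kern z * chi (n.+1%:R^-1 *: z + 0).
have n0 n : 0 < n.+1%:R^-1 :> R by rewrite invr_gt0.
have CF n : Cc (F n) by apply: CcMr; [exact: Cc_affine|exact: continuous_kern].
have kd0 : 2 * k * d%:R != 0 by rewrite !mulf_neq0// pnatr_eq0 -lt0n.
have [M HM] : exists M, forall n, intRd (F n) <= M.
  have /cvg_seq_bounded [M [_ HM]] : cvgn (fun n => 2 * k * d%:R * intRd (F n)).
    by apply/cvg_ex; eexists; exact: (cvg_intRd_kern (y := 0) tchi).
  exists (`|2 * k * d%:R|^-1 * (M + 1)) => n.
  rewrite ler_pdivlMl ?normr_gt0// (le_trans (ler_wpM2l _ (ler_norm _)))// -normrM.
  by apply: HM; rewrite ?ltrDl.
have : (\int[lebesgue_Rd d]_z (kern z * chi 0)%:E <= M%:E)%E.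
  apply: (@fatou_cvg R _ (borelRd R d) (lebesgue_Rd d) F (fun z => kern z * chi 0) M).
  - by move=> n; apply: continuous_measurable_rV; case: (CF n).
  - apply: continuous_measurable_rV; apply: continuous_mul; last exact: cst_continuous.
    exact: continuous_kern.
  - by move=> n z; rewrite mulr_ge0 ?box_bump_ge0// ltW// kern_gt0.
  - by move=> z; rewrite mulr_ge0 ?box_bump_ge0// ltW// kern_gt0.
  - move=> z; right; apply: cvgM; first exact: cvg_cst.
    by apply: cvg_scale_add; case: cchi.
  - by move=> n; rewrite (intRd_EFin (Cc_L1 (CF n))) lee_fin.
move=> HM'; have -> : @kern R d = fun z => (chi 0)^-1 * (kern z * chi 0).
  by apply/funext => z; rewrite mulrCA mulVf ?mulr1// gt_eqF.
apply: L1Z; apply/integrableP; split.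
  apply/measurable_EFinP; apply: continuous_measurable_rV.
  by apply: continuous_mul; [exact: continuous_kern|exact: cst_continuous].
apply: le_lt_trans (ltry M); apply: le_trans HM'; rewrite le_eqVlt; apply/orP; left.
apply/eqP; apply: eq_integral => z _ /=; rewrite ger0_norm// mulr_ge0 ?ltW//.
exact: kern_gt0.
Qed.

Lemma intRd_kern_gt0 : 0 < intRd (@kern R d).
Proof.
pose B : set 'rV[R]_d := [set x | forall i, - 1 <= x ord0 i <= 1].
have muB : lebesgue_Rd d B = (2 ^+ d)%:E.
  by rewrite /B lebesgue_Rd_box ?prodr_const ?card_ord ?opprK// => _; lra.
have mB : measurable (B : set (borelRd R d)).
  rewrite (_ : B = [set x : 'rV[R]_d | `|x| <= 1]); first exact: (measurable_closed_rV (@closed_ball_rV R d 1)).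
  apply/seteqP; split => x /= => [xB|x1 i].
    by apply: norm_le_coord => // i; rewrite ler_norml; exact: xB.
  by rewrite -ler_norml (le_trans (coord_le_norm _ _)).
(* On the cube |z|^2 <= d, so [kern] is at least [m] there. *)
pose m : R := (d%:R + 1) `^ (- (d%:R / 2) - 1).
have m0 : 0 < m by rewrite powR_gt0// ltr_wpDl.
have kernB x : B x -> m <= kern x.
  have : 0 <= d%:R / 2 :> R by rewrite divr_ge0.
  move=> dge0 xB; apply: le0_powR; [lra|exact: rsqd_gt0|].
  rewrite /rsqd lerD2r; apply: (@le_trans _ _ (\sum_(i < d) 1)).
    apply: ler_sum => i _; rewrite mxE subr0 -(real_normK (num_real _)).
    by rewrite exprn_ile1// ler_norml; exact: xB.
  by rewrite sumr_const card_ord.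
have mkern : measurable_fun setT (fun x : borelRd R d => (kern x)%:E).
  apply/measurable_EFinP; apply: continuous_measurable_rV; exact: continuous_kern.
rewrite -lte_fin -(intRd_EFin L1_kern).
apply: (@lt_le_trans _ _ (\int[lebesgue_Rd d]_(x in B) m%:E)%E).
  have -> : (\int[lebesgue_Rd d]_(x in B) m%:E = m%:E * (2 ^+ d)%:E)%E.
    by rewrite -muB; exact: integral_cst.
  by rewrite -EFinM lte_fin mulr_gt0// exprn_gt0.
apply: (@le_trans _ _ (\int[lebesgue_Rd d]_(x in B) (kern x)%:E)%E).
  apply: ge0_le_integral => //.
  - by move=> x _; rewrite lee_fin ltW.
  - exact: measurable_funTS.
apply: ge0_subset_integral => // x _; rewrite lee_fin ltW//; exact: kern_gt0.
Qed.

(** Now that [kern] is integrable, dominated convergence gives a second expression of the limit in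
    [cvg_intRd_kern], and the two must agree. *)
Lemma intRd_fundamental_solution chi y : test chi ->
  intRd (fun x => Phi (sqd y x) * laplacian chi x) = 2 * k * d%:R * intRd (@kern R d) * chi y.
Proof.
move=> tchi; have cchi := test_Cc tchi.
have [K [K0 chiK]] := Cc_bounded cchi.
pose F n (z : 'rV[R]_d) := kern z * chi (n.+1%:R^-1 *: z + y).
have n0 n : 0 < n.+1%:R^-1 :> R by rewrite invr_gt0.
have CF n : Cc (F n) by apply: CcMr; [exact: Cc_affine|exact: continuous_kern].
have cvgF : intRd (F n) @[n --> \oo] --> intRd (fun z => kern z * chi y).
  have mF n : measurable_fun setT (fun x : borelRd R d => (F n x)%:E).
    by apply/measurable_EFinP; apply: continuous_measurable_rV; case: (CF n).
  have L1y : L1 (fun z : 'rV[R]_d => kern z * chi y).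
    have -> : (fun z : 'rV[R]_d => kern z * chi y) = fun z => chi y * kern z.
      by apply/funext => z; rewrite mulrC.
    exact/L1Z/L1_kern.
  have [] := @dominated_convergence _ _ _ (lebesgue_Rd d) setT measurableT
    (fun n x => (F n x)%:E) (fun x => (kern x * chi y)%:E)
    (fun x => (K * kern x)%:E) mF (measurable_int _ L1y) _ (L1Z K L1_kern) _.
  - apply: aeW => x _; apply: cvg_EFin; first exact: nearW.
    by apply: cvgM; [exact: cvg_cst|apply: cvg_scale_add; case: cchi].
  - apply: aeW => x n _; rewrite /= lee_fin normrM mulrC ler_pM//.
    by rewrite ger0_norm// ltW// kern_gt0.
  move=> _ _ H; apply: fine_cvg; rewrite /intRd /Rintegral fineK//.
  by apply: integrable_fin_num.
have H : 2 * k * d%:R * intRd (F n) @[n --> \oo] --> 2 * k * d%:R * intRd (fun z => kern z * chi y).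
  by apply: cvgM; [exact: cvg_cst|exact: cvgF].
have H' := @cvg_intRd_kern chi y tchi.
rewrite (cvg_unique (@Rhausdorff R) H' H).
rewrite -[RHS]mulrA; congr (_ * _); rewrite [RHS]mulrC -intRdZ; last exact: L1_kern.
by apply: eq_intRd => z; rewrite mulrC.
Qed.


End fundamental_solution_identity.

Section powR_weight.
Context {R : realType} (d : nat).
Implicit Types (a s t : R).

Lemma powR_le_add1 a t : - (d.-1%:R / 2) <= a -> a <= 0 -> 0 < t ->
  t `^ a <= 1 + t `^ (- (d.-1%:R / 2)).
Proof.
move=> ab a0 t0; have [t1|t1] := leP 1 t.
  rewrite -[leLHS]addr0 lerD ?powR_ge0//.
  by rewrite -[leRHS](powRr0 t) ler_powR.
by rewrite -[leLHS]add0r lerD// ger_powR// t0 ltW.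
Qed.

Lemma powR_le_weight a t : - (d.-1%:R / 2) <= a -> a <= 1 -> 0 < t ->
  t `^ a <= weight d t.
Proof.
move=> ab a1 t0; have [t1|t1] := leP 1 t.
  apply: (@le_trans _ _ t); first by rewrite -[leRHS](powRr1 (ltW t0)) ler_powR.
  by rewrite /weight -addrA addrCA lerDl addr_ge0// powR_ge0.
apply: (@le_trans _ _ (t `^ (- (d.-1%:R / 2)))); first by rewrite ger_powR// t0 ltW.
by rewrite /weight lerDr addr_ge0// ltW.
Qed.

End powR_weight.

Section laplacian_step.
Context {R : realType} {d : nat}.
Hypothesis d0 : (0 < d)%N.
Implicit Types (y : 'rV[R]_d) (chi : 'rV[R]_d -> R).

(** The term in e of [intRd_rsqd_laplacian] tends to 0 for s > 0 and is dominated thanks to e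
    (s+e)^(p-2) <= (s+e)^(p-1). The hypotheses on [p] place both s^(p-1) and s^p below [weight]. *)
Lemma intRd_powR_laplacian (p : R) chi y : - (d.-1%:R / 2) <= p - 1 -> p <= 1 -> test chi ->
  intRd (fun x => sqd y x `^ p * laplacian chi x) =
  2 * p * (d%:R + 2 * p - 2) * intRd (fun x => sqd y x `^ (p - 1) * chi x).
Proof.
move=> p1 p2 tchi; have cchi := test_Cc tchi.
have Phi_le (t : R) : 0 < t -> `|t `^ p| <= 1 * weight d t.
  move=> t0; rewrite ger0_norm ?powR_ge0// mul1r powR_le_weight//.
  by apply: (le_trans p1); rewrite gerBl.
have [_ H] := intRd_cvg_rsqd d0 (@is_derive1_powR R p) (measurable_powR p) Phi_le y
  (test_Cc (test_laplacian tchi)).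
pose a : R := 2 * p * (d%:R + 2 * p - 2); pose b : R := 4 * p * (p - 1).
pose Psi n (s : R) := a * (s + eps n) `^ (p - 1) - b * (eps n * (s + eps n) `^ (p - 1 - 1)).
have E n : intRd (fun x => rsqd (eps n) y x `^ p * laplacian chi x) =
    intRd (fun x => Psi n (sqd y x) * chi x).
  exact: (intRd_rsqd_laplacian y (@eps_gt0 R n) (@is_derive1_powR R p) tchi).
have w2 n s : 0 < s -> (s + eps n) `^ (p - 1) <= 2 * weight d s.
  move=> s0; have e0 := @eps_gt0 R n.
  apply: le_trans _ (le_weight s0 e0 (@eps_le1 R n)).
  by apply: powR_le_weight; [|rewrite (le_trans _ p2) ?gerBl|rewrite addr_gt0].
have L1s : L1 (fun x => sqd y x `^ (p - 1) * chi x).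
  have [] := @intRd_cvg_sqd R d d0 (fun _ s => s `^ (p - 1)) (fun s => s `^ (p - 1)) 1 chi y cchi.
  - by move=> _; exact: measurable_powR.
  - exact: measurable_powR.
  - by move=> s _; exact: cvg_cst.
  - move=> _ s s0; rewrite ger0_norm ?powR_ge0// mul1r powR_le_weight//.
    by rewrite (le_trans _ p2) ?gerBl.
  - by [].
have me n : measurable_fun setT (fun s : R => s + eps n) by exact: measurable_funD.
have [] := @intRd_cvg_sqd _ _ d0 Psi (fun s => a * s `^ (p - 1)) ((`|a| + `|b|) * 2) chi y cchi.
- move=> n; apply: measurable_funB; apply: measurable_funM => //.
    exact: (measurableT_comp (measurable_powR _) (me n)).
  apply: measurable_funM => //.
  exact: (measurableT_comp (measurable_powR _) (me n)).
- by apply: measurable_funM => //; exact: measurable_powR.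
- move=> s s0; rewrite -[X in _ --> X]subr0; apply: cvgB.
    apply: cvgM; first exact: cvg_cst.
    exact: (cvg_gt0_eps s0 (@is_derive1_powR R _ _ s0)).
  have -> : 0 = b * (0 * s `^ (p - 1 - 1)) by rewrite mul0r mulr0.
  apply: cvgM; first exact: cvg_cst.
  apply: cvgM; first exact: cvg_eps.
  exact: (cvg_gt0_eps s0 (@is_derive1_powR R _ _ s0)).
- move=> n s s0; have e0 := @eps_gt0 R n; have se0 := addr_gt0 s0 e0.
  rewrite -mulrA mulrDl (le_trans (ler_normB _ _))// lerD// normrM ler_wpM2l//.
    by rewrite ger0_norm ?powR_ge0// w2.
  rewrite ger0_norm ?mulr_ge0 ?powR_ge0// ?(ltW e0)//.
  apply: le_trans (w2 n s s0); rewrite -(powR_pred (p - 1) se0) ler_wpM2r ?powR_ge0//.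
  by rewrite lerDr ltW.
move=> _ HPsi.
have HE : intRd (fun x => Psi n (sqd y x) * chi x) @[n --> \oo] -->
    intRd (fun x => sqd y x `^ p * laplacian chi x).
  by under eq_fun do rewrite -E; exact: H.
rewrite (cvg_unique (@Rhausdorff R) HE HPsi) -/a -intRdZ//.
by apply: eq_intRd => x; rewrite mulrA.
Qed.

End laplacian_step.

(** * The properties shared by the kernels *)

Section radial_kernel.
Context {R : realType} {d : nat}.
Implicit Types (y : 'rV[R]_d) (chi : 'rV[R]_d -> R).

(* The bound of [Phi t] by [Phi t0] controls the kernel at [x], up to a local
   singularity, by its value at a base point, where finite energy makes the
   kernel integrable. *)
Definition radial_kernel (G : 'rV[R]_d -> 'rV[R]_d -> \bar R) (Phi : R -> R) (N : nat) :=
  [/\ measurable_fun setT Phi,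
    exists C, forall t, 0 < t -> `|Phi t| <= C * weight d t,
    forall B, 0 <= B -> exists2 C, 0 <= C & forall t t0, 0 < t -> 0 <= t0 ->
      t <= 2 * B + 2 * t0 -> `|Phi t| <= C * (1 + t `^ (- (d.-1%:R / 2)) + `|Phi t0|),
    (forall x y, x != y -> G x y = (Phi (sqd y x))%:E) /\
      (forall x y, (`|Phi (sqd y x)|%:E <= `|G x y|)%E) &
    exists2 C, C != 0 & forall chi y, test chi ->
      intRd (fun x => Phi (sqd y x) * iter N.+1 laplacian chi x) = C * chi y].

Lemma test_iter_laplacian n chi : test chi -> test (iter n laplacian chi).
Proof. by move=> tchi; elim: n => [//|n IH]; exact: test_laplacian. Qed.

Lemma enorm_sub x y : enorm (x - y) = sqd y x `^ 2^-1 :> R.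
Proof.
rewrite powR12_sqrt ?sqd_ge0// /enorm; congr Num.sqrt.
by apply: eq_bigr => i _; rewrite !mxE.
Qed.

End radial_kernel.

(** * The Energy Distance and Coulomb kernels *)

Section energy_distance.
Context {R : realType} (m : nat).
Let d := m.*2.+1.
Implicit Types (y : 'rV[R]_d) (chi : 'rV[R]_d -> R).

Let d2 : d%:R = 2 * m%:R + 1 :> R.
Proof. by rewrite /d -addn1 natrD -muln2 natrM mulrC. Qed.

Let b2 : d.-1%:R / 2 = m%:R :> R.
Proof. by rewrite /d /= -muln2 natrM mulfK. Qed.

Lemma half_sub_nat_neq0 j : 2^-1 - j%:R != 0 :> R.
Proof.
apply/eqP => H; have : (j.*2)%:R = 1%:R :> R by rewrite -muln2 natrM; lra.
by move=> /eqP; rewrite eqr_nat => /eqP /(congr1 odd); rewrite odd_double.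
Qed.

(** At step j the exponent is p = 1/2 - j, which is never 0, and d + 2p - 2 = 2 (m - j) is positive
    for j < m. After m steps the exponent is 1/2 - m = 1 - d/2. *)
Lemma intRd_sqrt_iter_laplacian j : (j <= m)%N -> exists2 C : R, C != 0 &
  forall chi y, test chi ->
    intRd (fun x => sqd y x `^ 2^-1 * iter j laplacian chi x) =
    C * intRd (fun x => sqd y x `^ (2^-1 - j%:R) * chi x).
Proof.
elim: j => [|j IH] jm.
  by exists 1; rewrite ?oner_neq0// => chi y _; rewrite mul1r subr0.
have [C C0 HC] := IH (ltnW jm).
set p : R := 2^-1 - j%:R.
have jm' : j.+1%:R <= m%:R :> R by rewrite ler_nat.
have p0 : p != 0 by exact: half_sub_nat_neq0.
exists (C * (2 * p * (d%:R + 2 * p - 2))).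
  rewrite !mulf_neq0//.
  rewrite d2 /p -natr1 in jm' *; apply: lt0r_neq0; lra.
move=> chi y tchi; rewrite iterSr HC; last exact: test_laplacian.
rewrite intRd_powR_laplacian//.
- rewrite mulrA; congr (_ * _); apply: eq_intRd => x; congr (_ `^ _ * _).
  by rewrite /p; ring.
- rewrite b2 /p; rewrite -natr1 in jm'; lra.
- rewrite /p; have : 0 <= j%:R :> R by []. lra.
Qed.

Lemma radial_energy_distance :
  radial_kernel (@energy_distance_kernel R d) (fun t => - t `^ 2^-1) m.
Proof.
have w1 (t : R) : 0 < t -> t `^ 2^-1 <= weight d t.
  by move=> t0; apply: powR_le_weight => //; rewrite ?b2; have : 0 <= m%:R :> R by []; lra.
split.
- by apply: measurableT_comp => //; exact: measurable_powR.
- by exists 1 => t t0; rewrite normrN ger0_norm ?powR_ge0// mul1r w1.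
(* From 2 B + 2 t0 <= (2 B + 2) (1 + t0^(1/2))^2, after taking square roots. *)
- move=> B B0; exists ((2 * B + 2) `^ 2^-1); first exact: powR_ge0.
  move=> t t0 tgt0 t00 tB; rewrite !normrN !ger0_norm ?powR_ge0//.
  apply: (@le_trans _ _ ((2 * B + 2) `^ 2^-1 * (1 + t0 `^ 2^-1))); last first.
    by rewrite ler_wpM2l ?powR_ge0// lerD2r lerDl powR_ge0.
  have B2 : 0 <= 2 * B + 2 by lra.
  have r0 := powR_ge0 t0 2^-1.
  have E : 1 + t0 `^ 2^-1 = ((1 + t0 `^ 2^-1) ^+ 2) `^ 2^-1.
    by rewrite -powR_mulrn ?addr_ge0// -powRrM mulfV// powRr1 ?addr_ge0.
  rewrite E -powRM ?sqr_ge0//; apply: ge0_ler_powR; rewrite ?nnegrE ?(ltW tgt0)//.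
    by rewrite mulr_ge0// sqr_ge0.
  have st0 : (t0 `^ 2^-1) ^+ 2 = t0.
    by rewrite -powR_mulrn// -powRrM mulVf// powRr1.
  rewrite sqrrD st0 expr1n mul1r; nra.
- split=> x y; first by rewrite /energy_distance_kernel enorm_sub.
  by rewrite /energy_distance_kernel enorm_sub /=.
(* [m] Laplacians bring the exponent down to 1 - d/2, and one more reaches the fundamental solution;
   hence [m.+1] in all. *)
- have [C C0 HC] := intRd_sqrt_iter_laplacian (leqnn m).
  pose p : R := 2^-1 - m%:R; have pE : p = 1 - d%:R / 2 by rewrite d2 /p; field.
  have dp (t : R) : 0 < t -> is_derive t (1 : R) (fun t : R => t `^ p) (p * t `^ (- (d%:R / 2))).
    move=> t0; have := @is_derive1_powR R p t t0.
    by rewrite {3}pE addrAC subrr add0r.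
  have p0 : p != 0 by exact: half_sub_nat_neq0.
  have m0 : 0 <= m%:R :> R by [].
  have pw (t : R) : 0 < t -> `|t `^ p| <= 1 * weight d t.
    move=> t0; rewrite ger0_norm ?powR_ge0// mul1r; apply: powR_le_weight => //; rewrite /p ?b2; lra.
  have F := @intRd_fundamental_solution R d isT (fun t : R => t `^ p) p 1 dp (measurable_powR p) pw p0.
  exists (- (C * (2 * p * d%:R * intRd (@kern R d)))).
    rewrite oppr_eq0 !mulf_neq0// ?pnatr_eq0// gt_eqF//.
    exact: (intRd_kern_gt0 (d := d) isT dp (measurable_powR p) pw p0).
  move=> chi y tchi; have tL := test_laplacian tchi.
  rewrite (@eq_intRd _ _ _ (fun x => -1 * (sqd y x `^ 2^-1 * iter m.+1 laplacian chi x))); last first.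
    by move=> x; rewrite mulN1r mulNr.
  rewrite intRdZ.
    rewrite iterSr HC// -/p F//. by rewrite mulN1r mulNr !mulrA.
  have := intRd_cvg_rsqd (d := d) isT (@is_derive1_powR R 2^-1) (measurable_powR _) _ y
    (test_Cc (test_iter_laplacian m.+1 tchi)).
  move=> /(_ 1)[]// t t0; rewrite ger0_norm ?powR_ge0// mul1r; exact: w1.
Qed.

End energy_distance.

Section coulomb.
Context {R : realType}.

Lemma coulomb_kernel1 :
  @coulomb_kernel R 1 = @energy_distance_kernel R 1.
Proof. by []. Qed.

(** The inequality ln u < u bounds ln t from above at u = t, and from below at u = t^(-1/2). *)
Lemma norm_ln_le (t : R) : 0 < t -> `|ln t| <= 2 * (t + t `^ (- 2^-1)).
Proof.
move=> t0; rewrite ler_norml; apply/andP; split; last first.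
  by apply: (le_trans (ltW (ln_sublinear t0))); have := powR_ge0 t (- 2^-1); lra.
have := ln_sublinear (powR_gt0 (- 2^-1) t0); rewrite ln_powR.
lra.
Qed.

Lemma radial_coulomb2 :
  radial_kernel (@coulomb_kernel R 2) (fun t => - 2^-1 * ln t) 0.
Proof.
have mPhi : measurable_fun setT (fun t : R => - 2^-1 * ln t).
  by apply: measurable_funM => //; exact: measurable_ln.
have dPhi (t : R) : 0 < t ->
    is_derive t (1 : R) (fun s => - 2^-1 * ln s) (- 2^-1 * t `^ (- (2%:R / 2))).
  move=> t0; have H := is_deriveZ (- 2^-1) (is_derive1_ln t0).
  by apply: (is_derive_eq H); rewrite divff// powR_inv1// ltW.
have lnw (t : R) : 0 < t -> `|- 2^-1 * ln t| <= 1 * weight 2 t.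
  move=> t0; rewrite mul1r normrM normrN [`|2^-1|]ger0_norm// /weight [2.-1]/=.
  have := norm_ln_le t0; rewrite div1r; lra.
have k0 : - 2^-1 != 0 :> R by rewrite oppr_eq0 invr_eq0.
split => //.
- by exists 1.
(* For t < 1, half of |ln t| is at most the local singularity t^(-1/2); for t >= 1, ln t is at most
   ln (2 B + 2), plus ln t0 when t0 >= 1. *)
- move=> B B0; pose L := `|ln (2 * B + 2)|; exists (1 + L); first by rewrite /L addr_ge0.
  move=> t t0 tgt0 t00 tB; rewrite !normrM normrN [`|2^-1|]ger0_norm// /= div1r.
  have P0 := powR_ge0 t (- 2^-1).
  have L0 : 0 <= L by exact: normr_ge0.
  have A0 : 0 <= `|ln t0| by [].
  have B2 : 0 < 2 * B + 2 by lra.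
  have [t1|t1] := leP 1 t; last first.
    have lnt : `|ln t| <= 2 * t `^ (- 2^-1).
      rewrite ler0_norm ?ln_le0// ?ltW//.
      have := ln_sublinear (powR_gt0 (- 2^-1) tgt0); rewrite ln_powR; lra.
    nra.
  have lnt : `|ln t| <= L + `|ln t0|.
    rewrite ger0_norm ?ln_ge0//; have [t01|t01] := leP 1 t0.
      apply: (@le_trans _ _ (ln ((2 * B + 2) * t0))).
        rewrite ler_ln ?posrE ?mulr_gt0//; [nra|lra].
      rewrite lnM ?posrE//; last lra.
      by rewrite lerD// ler_norm.
    apply: (@le_trans _ _ (ln (2 * B + 2))); last first.
      by rewrite -[leLHS]addr0 lerD// ler_norm.
    by rewrite ler_ln ?posrE//; lra.
  nra.
- have E x y : @coulomb_kernel R 2 x y = (- lne (sqd y x `^ 2^-1)%:E)%E by rewrite -enorm_sub.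
  split=> x y; rewrite E.
    by move=> xy; rewrite lne_EFin ?powR_gt0 ?sqd_gt0// ln_powR -EFinN mulNr.
  have [->|xy] := eqVneq x y; first by rewrite sqdxx powR0//= ?lexx ?eqxx /= ?leey.
  rewrite lne_EFin ?powR_gt0 ?sqd_gt0// ln_powR mulNr normrN. by rewrite abseN abse_EFin.
- exists (2 * - 2^-1 * (2%:R : R) * intRd (@kern R 2)).
    rewrite !mulf_neq0// gt_eqF//; exact: (intRd_kern_gt0 (d := 2) isT dPhi mPhi lnw k0).
  by move=> chi y tchi; rewrite (intRd_fundamental_solution (d := 2) isT dPhi mPhi lnw k0).
Qed.

Lemma radial_coulomb (d : nat) : (2 < d)%N ->
  radial_kernel (@coulomb_kernel R d) (fun t => (d%:R - 2)^-1 * t `^ (1 - d%:R / 2)) 0.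
Proof.
move=> d2; have d0 : (0 < d)%N by rewrite (ltn_trans _ d2).
have d2R : 3 <= d%:R :> R by rewrite ler_nat.
have dB : 0 < d%:R - 2 :> R by lra.
have k0 : - 2^-1 != 0 :> R by rewrite oppr_eq0 invr_eq0.
have b2 : d.-1%:R = d%:R - 1 :> R by rewrite -subn1 natrB.
set p : R := 1 - d%:R / 2.
have p1 : - (d.-1%:R / 2) <= p by rewrite b2 /p; lra.
have p0 : p <= 0 by rewrite /p; lra.
have i0 : 0 <= (d%:R - 2)^-1 :> R by rewrite invr_ge0 ltW.
have mPhi : measurable_fun setT (fun t : R => (d%:R - 2)^-1 * t `^ p).
  by apply: measurable_funM => //; exact: measurable_powR.
have dPhi (t : R) : 0 < t ->
    is_derive t (1 : R) (fun s => (d%:R - 2)^-1 * s `^ p) (- 2^-1 * t `^ (- (d%:R / 2))).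
  move=> t0; have H := is_deriveZ (d%:R - 2)^-1 (is_derive1_powR p t0).
  apply: (is_derive_eq H); rewrite /GRing.scale /= mulrA.
  have -> : p - 1 = - (d%:R / 2) by rewrite /p; ring.
  congr (_ * _); rewrite /p; field; lra.
have pw (t : R) : 0 < t -> `|(d%:R - 2)^-1 * t `^ p| <= (d%:R - 2)^-1 * weight d t.
  move=> t0; rewrite ger0_norm ?mulr_ge0 ?powR_ge0// ler_wpM2l//.
  by apply: powR_le_weight => //; rewrite (le_trans p0).
split => //.
- by exists (d%:R - 2)^-1.
(* The exponent 1 - d/2 lies between -(d-1)/2 and 0, so 1 and the local singularity already dominate
   the power. *)
- move=> B B0; exists (d%:R - 2)^-1 => // t t0 tgt0 _ _.
  rewrite [leLHS]ger0_norm ?mulr_ge0 ?powR_ge0// ler_wpM2l//.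
  by apply: (le_trans (powR_le_add1 p1 p0 tgt0)); rewrite lerDl.
- have E (x y : 'rV[R]_d) : coulomb_kernel x y = (((d%:R - 2) * sqd y x `^ (- p))%:E^-1)%E.
    have d1 : (1 < d)%N by rewrite (ltn_trans _ d2).
    rewrite /coulomb_kernel (gtn_eqF d1) (gtn_eqF d2) enorm_sub.
    rewrite -powR_mulrn ?powR_ge0// -powRrM natrB ?(ltnW d2)//.
    have -> : 2^-1 * (d%:R - 2) = - p :> R by rewrite /p; field.
    by [].
  split=> x y.
    move=> xy; rewrite E; have s0 := sqd_gt0 xy.
    by rewrite inver mulf_eq0 !gt_eqF ?powR_gt0//= invfM powRN invrK.
  rewrite E; have [xy|xy] := eqVneq x y.
    (* On the diagonal the left-hand side has the default value 0 and the kernel is +oo. *)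
    have pN0 : - p != 0 by rewrite oppr_eq0 lt_eqF// /p; lra.
    by rewrite xy sqdxx (powR0 pN0) mulr0 inve0 /= leey.
  rewrite inver mulf_eq0 !gt_eqF ?powR_gt0 ?sqd_gt0//= invfM powRN invrK.
  exact: lexx.
- exists (2 * - 2^-1 * d%:R * intRd (@kern R d)).
    rewrite !mulf_neq0// ?pnatr_eq0 -?lt0n// gt_eqF//.
    exact: (intRd_kern_gt0 d0 dPhi mPhi pw k0).
  by move=> chi y tchi; rewrite (intRd_fundamental_solution d0 dPhi mPhi pw k0).
Qed.

End coulomb.

(** * Potentials of measures of finite energy *)

Section potential.
Context {R : realType} {d : nat}.
Hypothesis d0 : (0 < d)%N.
Variables (G : 'rV[R]_d -> 'rV[R]_d -> \bar R) (Phi : R -> R) (N : nat).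
Hypothesis rG : radial_kernel G Phi N.
Variable mu : probability (borelRd R d) R.
Hypothesis hmu : finite_energy G mu.
Implicit Types (x y : 'rV[R]_d) (f : 'rV[R]_d -> R).

Lemma ae_exists (P : borelRd R d -> Prop) : {ae mu, forall x, P x} -> exists x, P x.
Proof.
move=> [S [mS S0 PS]]; apply: contrapT => nP.
have : mu setT = 0%E.
  apply/eqP; rewrite -measure_le0 -S0; apply: le_measure; rewrite ?inE// => x _.
  by apply: PS => Px; apply: nP; exists x.
by rewrite probability_setT => /eqP; rewrite onee_eq0.
Qed.

Lemma measurable_kernel :
  measurable_fun setT (fun p : borelRd R d * borelRd R d => G p.1 p.2).
Proof. exact: measurable_int hmu. Qed.

(** For mu-almost every x the kernel is integrable in y, and a property true almost everywhere for a
    probability holds somewhere. This provides the base point of the bounds below. *)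
Lemma exists_integrable_kernel : exists x0 : 'rV[R]_d,
  mu.-integrable setT (fun y : borelRd R d => G x0 y).
Proof. exact: ae_exists (ae_integrable1 hmu). Qed.

(** With [z] the base point, the origin of [2 * B + 2 * t0] in [radial_kernel]. *)
Lemma sqd_triangle x y z : sqd y x <= 2 * sqd z x + 2 * sqd z y.
Proof.
rewrite /sqd !mulr_sumr -big_split/=; apply: ler_sum => i _.
have := sqr_ge0 ((x 0 i - z 0 i) + (y 0 i - z 0 i)); lra.
Qed.

Lemma sqd_le_ball z (M : R) : exists2 B, 0 <= B & forall x, `|x| <= M -> sqd z x <= B.
Proof.
exists (\sum_(i < d) (`|M| + `|z 0 i|) ^+ 2).
  by apply: sumr_ge0 => i _; exact: sqr_ge0.
move=> x xM; apply: ler_sum => i _; rewrite -(real_normK (num_real _)).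
rewrite ler_sqr ?nnegrE ?addr_ge0//; apply: (le_trans (ler_normB _ _)); rewrite lerD2r.
by apply: (le_trans (coord_le_norm x i)); apply: (le_trans xM); exact: ler_norm.
Qed.

Let F f (p : borelRd R d * borelRd R d) : \bar R := (G p.1 p.2 * (f p.1)%:E)%E.

Lemma measurable_F f : continuous f -> measurable_fun setT (F f).
Proof.
move=> cf; apply: emeasurable_funM; first exact: measurable_kernel.
apply/measurable_EFinP; apply: measurableT_comp => //.
exact: continuous_measurable_rV.
Qed.

(** On the support of [f] the distance from x to x0 is bounded, so [radial_kernel] controls the
    kernel at (x, y) by 1, the local singularity and its value at (x0, y). Integrated in x against
    [|f|], the singularity contributes a constant uniform in [y], and the resulting bound is
    integrable in [y]. *)
Lemma integral_norm_F_le f : Cc f -> exists a b x0, [/\ 0 <= a, 0 <= b,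
  mu.-integrable setT (fun y : borelRd R d => G x0 y) &
  forall y, (\int[lebesgue_Rd d]_x `|F f (x, y)| <= a%:E + b%:E * `|G x0 y|)%E].
Proof.
move=> cf; have [x0 ix0] := exists_integrable_kernel.
have [_ _ HB [G1 G2] _] := rG.
have [_ [M fM]] := cf; have [B B0 HBM] := sqd_le_ball x0 M.
have [C C0 HC] := HB B B0.
have ad : (d.-1 < d)%N by rewrite prednK.
have [C' C'0 HC'] := sqd_integral_bound ad cf.
have cnf := Cc_norm cf.
exists (C * intRd (fun x => `|f x|) + C * C'), (C * intRd (fun x => `|f x|)), x0; split => //.
- by rewrite addr_ge0// mulr_ge0// intRd_ge0.
- by rewrite mulr_ge0// intRd_ge0.
move=> y; set P := `|Phi (sqd x0 y)|.
have P0 : 0 <= P by exact: normr_ge0.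
pose s x := `|f x| * sqd y x `^ (- (d.-1%:R / 2)).
have Ls : L1 s by apply: L1_sqd_powR => //; rewrite prednK.
pose h x := (C * (1 + P)) * `|f x| + C * s x.
have L2 : L1 (fun x => (C * (1 + P)) * `|f x|) by apply/L1Z/Cc_L1.
have L3 : L1 (fun x => C * s x) by exact: L1Z.
have Lh : L1 h by exact: L1D.
apply: (@le_trans _ _ (\int[lebesgue_Rd d]_x (h x)%:E)%E).
  apply: ae_ge0_le_integral => //.
  - apply: measurableT_comp => //.
    have cf' : continuous f by case: cf.
    exact: (measurableT_comp (measurable_F cf') (pair2_measurable (y : borelRd R d))).
  - by move=> x _; rewrite lee_fin addr_ge0// !mulr_ge0// ?addr_ge0// ?powR_ge0.
  - by case/integrableP : Lh.
  - apply: (@ae_neq _ _ d0 y) => x xy _; rewrite /F /= G1// -EFinM /= lee_fin normrM.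
    have [Mx|Mx] := ltP M `|x|.
      by rewrite /h /s fM// normr0 mulr0 mul0r !mulr0 addr0.
    have := HC (sqd y x) (sqd x0 y) (sqd_gt0 xy) (sqd_ge0 x0 y).
    have : sqd y x <= 2 * B + 2 * sqd x0 y.
      apply: (le_trans (sqd_triangle x y x0)); rewrite lerD2r ler_pM2l//.
      exact: HBM.
    move=> st /(_ st) H; apply: (le_trans (ler_wpM2r (normr_ge0 _) H)).
    rewrite /h /s /P le_eqVlt; apply/orP; left; apply/eqP; ring.
rewrite (intRd_EFin Lh) intRdD// !intRdZ//; last exact: Cc_L1.
apply: (@le_trans _ _ ((C * intRd (fun x => `|f x|) + C * C') + C * intRd (fun x => `|f x|) * P)%:E).
  rewrite lee_fin mulrDr mulr1 mulrDl -mulrA addrAC -addrA.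
  have : intRd s <= C' by rewrite -lee_fin -(intRd_EFin Ls); exact: HC'.
  move=> /(ler_wpM2l C0); rewrite -/(P); lra.
rewrite EFinD EFinM leeD2l// lee_wpmul2l ?lee_fin ?mulr_ge0 ?intRd_ge0//.
by rewrite /P sqdC; exact: G2.
Qed.

Lemma integrable_F f : Cc f -> (lebesgue_Rd d \x mu)%E.-integrable setT (F f).
Proof.
move=> cf; have mF : measurable_fun setT (F f) by apply: measurable_F; case: cf.
apply/(integrable21ltyP (lebesgue_Rd d) mu mF).
have [a [b [x0 [a0 b0 ix0 H]]]] := integral_norm_F_le cf.
have iU : mu.-integrable setT (fun y : borelRd R d => a%:E + b%:E * `|G x0 y|)%E.
  apply: integrableD => //; first exact: finite_measure_integrable_cst.
  by apply: integrableZl => //; exact: integrable_abse.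
apply: le_lt_trans (integrable_lty _ iU) => //.
apply: ge0_le_integral => //.
- by move=> y _; apply: integral_ge0.
- apply: (@measurable_fun_fubini_tonelli_G _ _ _ _ _ (lebesgue_Rd d) (fun p => `|F f p|%E)) => //.
  exact: measurableT_comp.
- by case/integrableP : iU.
Qed.

Lemma L1_Phi f y : Cc f -> L1 (fun x => Phi (sqd y x) * f x).
Proof.
move=> cf; have [mPhi [C HC] _ _ _] := rG.
by have [] := @intRd_cvg_sqd R d d0 (fun=> Phi) Phi C f y cf (fun=> mPhi) mPhi
  (fun s _ => cvg_cst _) (fun _ s => HC s).
Qed.

Lemma fubini_G_F f : Cc f ->
  fubini_G (lebesgue_Rd d) (F f) = fun y => (intRd (fun x => Phi (sqd y x) * f x))%:E.
Proof.
move=> cf; apply/funext => y; rewrite -(intRd_EFin (L1_Phi y cf)).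
have [_ _ _ [G1 _] _] := rG; apply: ae_eq_integral => //.
- have mF : measurable_fun setT (F f) by apply: measurable_F; case: cf.
  exact: (measurableT_comp mF (pair2_measurable (y : borelRd R d))).
- by case/integrableP : (L1_Phi y cf).
- by apply: (@ae_neq _ _ d0 y) => x xy _; rewrite /F /= G1.
Qed.

Lemma integrable_smoothed f : Cc f ->
  mu.-integrable setT (fun y : borelRd R d => (intRd (fun x => Phi (sqd y x) * f x))%:E).
Proof.
move=> cf; have iF := integrable_F cf; have mF := measurable_int _ iF.
have mG := measurable_fubini_G iF.
rewrite -fubini_G_F//; apply/integrableP; split => //.
apply: le_lt_trans ((integrable21ltyP _ _ mF).1 iF); apply: ge0_le_integral => //.
- exact: measurableT_comp.
- apply: (@measurable_fun_fubini_tonelli_G _ _ _ _ _ (lebesgue_Rd d) (fun p => `|F f p|%E)) => //.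
  exact: measurableT_comp.
- move=> y _; apply: le_abse_integral => //.
  exact: (measurableT_comp mF (pair2_measurable (y : borelRd R d))).
Qed.

Lemma integral_fubini_F f : Cc f ->
  (\int[lebesgue_Rd d]_x fubini_F mu (F f) x =
   \int[mu]_y (intRd (fun x => Phi (sqd y x) * f x))%:E)%E.
Proof.
move=> cf; rewrite -fubini_G_F//.
by rewrite integral12_prod_meas1 ?integral21_prod_meas1//; exact: integrable_F.
Qed.

(** At a given x the kernel need not be integrable in y, so Tonelli is applied to the positive and
    negative parts, whose difference defines the integral in every case. *)
Lemma measurable_potential : measurable_fun setT (potential G mu : borelRd R d -> \bar R).
Proof.
have mG := measurable_kernel.
pose H : borelRd R d * borelRd R d -> \bar R := fun p => G p.1 p.2.
rewrite (_ : potential G mu = fun x => (fubini_F mu H^\+ x - fubini_F mu H^\- x)%E).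
  apply: emeasurable_funB; apply: measurable_fun_fubini_tonelli_F => //.
  - exact: measurable_funepos.
  - exact: measurable_funeneg.
apply/funext => x; rewrite /potential (_ : (fun y => G x y) = H \o pair x)//.
by rewrite integralE funepos_comp funeneg_comp.
Qed.

(** Fubini gives integrability in y of the kernel multiplied by f(x); the potential is recovered by
    division where f(x) is not 0. *)
Lemma ae_potential_mul f : Cc f ->
  {ae lebesgue_Rd d, forall x : borelRd R d, fubini_F mu (F f) x \is a fin_num /\
    (f x != 0 -> potential G mu x \is a fin_num /\
      fubini_F mu (F f) x = (potential G mu x * (f x)%:E)%E)}.
Proof.
move=> cf; have := ae_integrable1 (integrable_F cf); apply: filterS => x ix.
split; first exact: integrable_fin_num.
move=> fx0.
have iG : mu.-integrable setT (fun y : borelRd R d => G x y).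
  have := integrableZr measurableT (f x)^-1 ix.
  apply: eq_integrable => // y _; rewrite /F /= -muleA -EFinM mulfV// mule1//.
split; first exact: integrable_fin_num.
by rewrite /fubini_F /F /= integralZr.
Qed.

End potential.

Section smoothed_potentials.
Context {R : realType} {d : nat}.
Hypothesis d0 : (0 < d)%N.
Variables (G : 'rV[R]_d -> 'rV[R]_d -> \bar R) (Phi : R -> R) (N : nat).
Hypothesis rG : radial_kernel G Phi N.
Variables mu nu : probability (borelRd R d) R.
Hypotheses (hmu : finite_energy G mu) (hnu : finite_energy G nu).

Lemma integral_first_variation (f : 'rV[R]_d -> R) : Cc f ->
  (\int[lebesgue_Rd d]_x (mmd_first_variation G nu mu x * (f x)%:E) =
   \int[mu]_y (intRd (fun x => Phi (sqd y x) * f x)%R)%:E -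
   \int[nu]_y (intRd (fun x => Phi (sqd y x) * f x)%R)%:E)%E.
Proof.
move=> cf; rewrite -(integral_fubini_F d0 rG hmu cf) -(integral_fubini_F d0 rG hnu cf).
have imu := integrable_fubini_F (integrable_F d0 rG hmu cf).
have inu := integrable_fubini_F (integrable_F d0 rG hnu cf).
rewrite -integralB//; apply: ae_eq_integral => //.
- apply: emeasurable_funM.
    apply: emeasurable_funB; exact: measurable_potential.
  by apply/measurable_EFinP; apply: continuous_measurable_rV; case: cf.
- by apply: emeasurable_funB; [case/integrableP : imu|case/integrableP : inu].
- have := ae_potential_mul d0 rG hmu cf; have := ae_potential_mul d0 rG hnu cf.
  apply: filterS2 => x [nfin Hnu] [mfin Hmu] _.
  (* Where [f] vanishes the products are 0 even if a potential is infinite; elsewhere both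
     potentials are finite and the difference distributes. *)
  have [fx0|fx0] := eqVneq (f x) 0.
    rewrite fx0 mule0 /fubini_F /=; under eq_integral do rewrite fx0 mule0.
    by under [X in (_ - X)%E]eq_integral do rewrite fx0 mule0; rewrite !integral0 subee.
  have [p1 ->] := Hmu fx0; have [p2 ->] := Hnu fx0.
  by rewrite /mmd_first_variation muleBl// fin_num_adde_defr.
Qed.

End smoothed_potentials.

(** * Equality of the measures *)

Section supported.
Context {R : realType} {d : nat}.
Implicit Types (f : 'rV[R]_d -> R) (K A : set 'rV[R]_d).

(** Vanishing outside [K] passes pointwise to derivatives when [K] is closed; the closure in
    [test_function] is recovered by [supported_test_function]. *)
Definition supported K f := smooth f /\ forall x, ~ K x -> f x = 0.

Lemma compact_closed_rV K : compact K -> closed K.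
Proof. by apply: compact_closed; exact: norm_hausdorff. Qed.

Lemma supported_test_function A K f : compact K -> K `<=` A -> supported K f ->
  test_function A f.
Proof.
move=> cK KA [sf fK]; have clK := compact_closed_rV cK.
have SK : closure [set x | f x != 0] `<=` K.
  rewrite [X in _ `<=` X](closure_id K).1//; apply: closure_subset => x /= fx0.
  by apply: contrapT => /fK fx; rewrite fx eqxx in fx0.
split => //; last exact: subset_trans KA.
by apply: (subclosed_compact _ cK SK); exact: closed_closure.
Qed.

Lemma supported_test K f : compact K -> supported K f -> test f.
Proof.
move=> cK [sf fK]; split => //.
have [M [_ HM]] := compact_bounded cK.
exists (M + 1) => x Mx; apply: fK => Kx.
have M1 : M < M + 1 by rewrite ltrDl.
by have := HM _ M1 x Kx; rewrite /= leNgt Mx.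
Qed.

Lemma supported_pderiv K f i : closed K -> supported K f -> supported K (pderiv i f).
Proof.
move=> clK [sf fK]; split; first exact: smooth_pderiv.
move=> x nKx; apply: (is_derive_unique (smooth_is_derive i x sf)).
apply: (@near_eq_is_derive _ _ _ (cst 0)).
  have : \forall y \near x, (~` K) y by apply: open_nbhs_nbhs; split => //; exact: closed_openC.
  by apply: filterS => y /fK ->.
Qed.

Lemma supported_laplacian K f : closed K -> supported K f -> supported K (laplacian f).
Proof.
move=> clK sf; split.
  apply: smooth_sum => i; apply: smooth_pderiv; apply: smooth_pderiv; by case: sf.
move=> x nKx; apply: big1 => i _.
by have [_] := supported_pderiv i clK (supported_pderiv i clK sf); apply.
Qed.

End supported.

(** * From test functions to boxes, and from boxes to Borel sets *)

Section conclusion.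
Context {R : realType} {d : nat}.
Hypothesis d0 : (0 < d)%N.
Variables (G : 'rV[R]_d -> 'rV[R]_d -> \bar R) (Phi : R -> R) (N : nat).
Hypothesis rG : radial_kernel G Phi N.
Variables mu nu : probability (borelRd R d) R.
Hypotheses (hmu : finite_energy G mu) (hnu : finite_energy G nu).
Hypothesis hcrit : lagrangian_critical (mmd_first_variation G nu) mu.
Implicit Types (chi : 'rV[R]_d -> R) (K A : set 'rV[R]_d) (a b : 'I_d -> R).

Lemma integral_iter_laplacian (rho : probability (borelRd R d) R) chi :
  finite_energy G rho -> test chi ->
  (\int[rho]_y (intRd (fun x => Phi (sqd y x) * iter N.+1 laplacian chi x)%R)%:E =
   \sum_(i < d) \int[rho]_y
     (intRd (fun x => Phi (sqd y x) * pderiv i (pderiv i (iter N laplacian chi)) x)%R)%:E)%E.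
Proof.
move=> hrho tchi; have tN := test_iter_laplacian N tchi.
have cN i : Cc (pderiv i (pderiv i (iter N laplacian chi))).
  by apply: test_Cc; do 2 apply: test_pderiv.
rewrite -integral_sum//; last by move=> i; exact: (integrable_smoothed d0 rG hrho (cN i)).
apply: eq_integral => y _; rewrite sumEFin -intRd_sum; last first.
  by move=> i; exact: (L1_Phi d0 rG y (cN i)).
by congr EFin; apply: eq_intRd => x; rewrite mulr_sumr.
Qed.

Lemma integral_supported_eq K chi : compact K -> K `<=` msupport mu -> supported K chi ->
  (\int[mu]_y (chi y)%:E = \int[nu]_y (chi y)%:E)%E.
Proof.
move=> cK KS schi; have clK := compact_closed_rV cK.
have tchi := supported_test cK schi.
have tN := test_iter_laplacian N tchi.
have sN : supported K (iter N laplacian chi).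
  by elim: (N) => [//|n IH]; exact: supported_laplacian.
have E i : (\int[mu]_y
     (intRd (fun x => Phi (sqd y x) * pderiv i (pderiv i (iter N laplacian chi)) x)%R)%:E =
   \int[nu]_y
     (intRd (fun x => Phi (sqd y x) * pderiv i (pderiv i (iter N laplacian chi)) x)%R)%:E)%E.
  have cN : Cc (pderiv i (pderiv i (iter N laplacian chi))).
    by apply: test_Cc; do 2 apply: test_pderiv.
  (* The equation is tested on [pderiv i (iter N laplacian chi)], so that the derivative in
     [distr_pderiv] turns it into the i-th term of the next Laplacian. *)
  have := hcrit i (supported_test_function cK KS (supported_pderiv i clK sN)).
  rewrite /distr_pderiv (integral_first_variation d0 rG hmu hnu cN).
  have fmu := integrable_fin_num measurableT (integrable_smoothed d0 rG hmu cN).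
  have fnu := integrable_fin_num measurableT (integrable_smoothed d0 rG hnu cN).
  by move=> /eqP; rewrite oppe_eq0 sube_eq// ?fin_num_adde_defl// add0e => /eqP.
have [_ _ _ _ [C C0 HC]] := rG.
have ichi (rho : probability (borelRd R d) R) :
    rho.-integrable setT (fun y : borelRd R d => (chi y)%:E).
  have [B [B0 HB]] := Cc_bounded (test_Cc tchi).
  apply: (@le_integrable _ _ _ rho setT measurableT _ (cst B%:E)) => //.
  - by apply/measurable_EFinP; apply: continuous_measurable_rV; case: (test_Cc tchi).
  - by move=> y _ /=; rewrite lee_fin (ger0_norm B0).
  - exact: finite_measure_integrable_cst.
have H (rho : probability (borelRd R d) R) : finite_energy G rho ->
    (C%:E * \int[rho]_y (chi y)%:E = \sum_(i < d) \int[rho]_y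
     (intRd (fun x => Phi (sqd y x) * pderiv i (pderiv i (iter N laplacian chi)) x)%R)%:E)%E.
  move=> hrho; rewrite -integral_iter_laplacian// -integralZl//; last exact: ichi.
  by apply: eq_integral => y _; rewrite HC.
have : (C%:E * \int[mu]_y (chi y)%:E = C%:E * \int[nu]_y (chi y)%:E)%E.
  by rewrite !H//; apply: eq_bigr => i _; exact: E.
have -> : (\int[mu]_y (chi y)%:E = (fine (\int[mu]_y (chi y)%:E))%:E)%E.
  by rewrite fineK//; apply: integrable_fin_num => //; exact: ichi.
have -> : (\int[nu]_y (chi y)%:E = (fine (\int[nu]_y (chi y)%:E))%:E)%E.
  by rewrite fineK//; apply: integrable_fin_num => //; exact: ichi.
by rewrite -!EFinM => -[/(mulfI C0) ->].
Qed.

Definition box a b : set 'rV[R]_d := [set x | forall i, a i < x 0 i < b i].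

Lemma box_bigcap a b : box a b = \bigcap_(i in setT)
  ((fun x : 'rV[R]_d => x 0 i) @^-1` `](a i), (b i)[).
Proof.
apply/seteqP; split => x /= H i; first by move=> _ /=; rewrite in_itv/=; exact: H.
by have := H i I; rewrite /= in_itv.
Qed.

Lemma measurable_box a b : measurable (box a b : set (borelRd R d)).
Proof.
rewrite box_bigcap; apply: fin_bigcap_measurable => [|i _]; first exact: finite_finset.
by rewrite -[X in measurable X]setTI; exact: measurable_coord.
Qed.

Lemma measure_box_eq a b : box a b `<=` msupport mu -> mu (box a b) = nu (box a b).
Proof.
move=> abS.
pose a' n i := a i + n.+1%:R^-1; pose b' n i := b i - n.+1%:R^-1.
pose chi n := box_bump n.+1%:R (a' n) (b' n).
have e0 n : 0 < n.+1%:R^-1 :> R by rewrite invr_gt0.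
(* The closed shrunken box, possibly empty for small [n], is a compact set inside the open box. *)
pose K n : set 'rV[R]_d := [set x | forall i, `[(a' n i), (b' n i)]%classic (x ord0 i)].
have cK n : compact (K n).
  by apply: (rV_compact (A := fun i => `[(a' n i), (b' n i)]%classic)) => i; exact: segment_compact.
have KS n : K n `<=` msupport mu.
  move=> x Kx; apply: abS => i; have := Kx i; rewrite /= in_itv/= /a' /b' => /andP[].
  by move: (n.+1%:R^-1) (e0 n) => e e0' ? ?; apply/andP; split; lra.
have schi n : supported (K n) (chi n).
  split; first exact: smooth_box_bump.
  move=> x nKx; apply: box_bump_eq0; rewrite ?ltr0n// => H; apply: nKx => i.
  by rewrite /= in_itv/=; have /andP[/ltW -> /ltW ->] := H i.
have cvgchi (rho : probability (borelRd R d) R) :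
    (\int[rho]_y (chi n y)%:E @[n --> \oo] --> rho (box a b))%E.
  have := @dominated_convergence _ _ _ rho setT measurableT
    (fun n y => (chi n y)%:E) (fun y => (\1_(box a b) y)%:E) (cst 1%E).
  rewrite integral_indic ?setIT//; last exact: measurable_box.
  case=> //.
  - move=> n; apply/measurable_EFinP; apply: continuous_measurable_rV.
    exact/smooth_continuous/smooth_box_bump.
  - by apply/measurable_EFinP; apply: measurable_indic; exact: measurable_box.
  - apply: aeW => y _; apply: cvg_EFin; first exact: nearW.
    exact: cvg_inner_box_bump.
  - exact: finite_measure_integrable_cst.
  - apply: aeW => y n _ /=; rewrite lee_fin ger0_norm ?box_bump_ge0//.
    exact: box_bump_le1.
have H : (fun n => \int[mu]_y (chi n y)%:E)%E = (fun n => \int[nu]_y (chi n y)%:E)%E.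
  by apply/funext => n; exact: integral_supported_eq (cK n) (KS n) (schi n).
have := cvgchi nu; rewrite -H => /(cvg_unique _ (cvgchi mu)); apply.
exact: ereal_hausdorff.
Qed.

Lemma boxI a b a' b' : box a b `&` box a' b' =
  box (fun i => Num.max (a i) (a' i)) (fun i => Num.min (b i) (b' i)).
Proof.
apply/seteqP; split => x /=.
  move=> [H H'] i; rewrite gt_max lt_min.
  by have /andP[-> ->] := H i; have /andP[-> ->] := H' i.
move=> H; split => i; have := H i; rewrite gt_max lt_min.
  by move=> /andP[/andP[-> _] /andP[-> _]].
by move=> /andP[/andP[_ ->] /andP[_ ->]].
Qed.

Lemma open_bigcup_ratbox (U : set 'rV[R]_d) : open U -> exists B : nat -> set 'rV[R]_d,
  U = \bigcup_n B n /\ forall n, exists a b, B n = box a b /\ box a b `<=` U.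
Proof.
move=> oU.
pose rbox (r : {ffun 'I_d -> rat * rat}) := box (fun i => ratr (r i).1) (fun i => ratr (r i).2).
pose i0 : 'I_d := Ordinal d0.
(* Since d > 0, a box with equal bounds is empty; it stands in for the indices that do not encode a
   box inside [U]. *)
have box0 : box (fun=> 0) (fun=> 0) = set0.
  by apply/seteqP; split => // x /(_ i0) /andP[x0] /(lt_trans x0); rewrite ltxx.
pose B n : set 'rV[R]_d := if unpickle n is Some r then
  if pselect (rbox r `<=` U) then rbox r else set0 else set0.
have UE := open_bigcup_box oU.
have rboxE r : rbox r = \bigcap_(i in setT) [set x : 'rV[R]_d | ratr (r i).1 < x 0 i < ratr (r i).2].
  by apply/seteqP; split => [x H i _|x H i]; [exact: H|exact: (H i I)].
exists B; split.
  apply/seteqP; split => x.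
    move=> Ux; move: (Ux); rewrite {1}UE; case=> r rU rx; exists (pickle r) => //.
    rewrite /B pickleK; case: pselect => [rU'|nrU]; first by rewrite /= rboxE.
    by apply: nrU; rewrite rboxE.
  move=> [n _]; rewrite /B; case: unpickle => [r|//].
  by case: pselect => // rU; exact: rU.
move=> n; rewrite /B; case: unpickle => [r|]; last first.
  by exists (fun=> 0), (fun=> 0); rewrite box0; split => //; exact: sub0set.
case: pselect => rU; last by exists (fun=> 0), (fun=> 0); rewrite box0; split => //; exact: sub0set.
by exists (fun i => ratr (r i).1), (fun i => ratr (r i).2).
Qed.

Definition boxes : set (set (borelRd R d)) := [set B | exists a b, B = box a b].

Lemma measurable_boxesE : @measurable _ (borelRd R d) = <<s boxes >>.
Proof.
apply/seteqP; split; apply: smallest_sub.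
- exact: smallest_sigma_algebra.
- move=> U oU; have [B [-> HB]] := open_bigcup_ratbox oU.
  apply: (@bigcupT_measurable _ (g_sigma_algebraType boxes)) => n.
  by apply: sub_sigma_algebra; have [a [b [-> _]]] := HB n; exists a, b.
- exact: sigma_algebra_measurable.
- by move=> _ [a [b ->]]; exact: measurable_box.
Qed.

(** The measures are known to agree only on boxes inside the support. Restricted to one such box
    they agree on every box, because boxes are stable under intersection, and then on Borel sets by
    uniqueness on a generating pi-system. *)
Lemma measure_setI_box_eq a b : box a b `<=` msupport mu ->
  forall E : set (borelRd R d), measurable E -> mu (E `&` box a b) = nu (E `&` box a b).
Proof.
move=> abS; have mB := measurable_box a b.
apply: (@measure_unique _ R (borelRd R d) boxes (fun n => box (fun=> - n%:R) (fun=> n%:R))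
  measurable_boxesE _ _ _ (mrestr mu mB) (mrestr nu mB)).
- by move=> _ _ [a1 [b1 ->]] [a2 [b2 ->]]; rewrite boxI; eexists; eexists.
- by move=> n; eexists; eexists.
- apply/seteqP; split => // x _.
  exists (Num.truncn `|x : 'rV[R]_d|).+1 => // i.
  by rewrite -ltr_norml (le_lt_trans (coord_le_norm x i))// truncnS_gt.
- move=> _ [a1 [b1 ->]]; rewrite /= /mrestr boxI; apply: measure_box_eq.
  rewrite -boxI; exact: subset_trans (@subIsetr _ _ _) abS.
- move=> n; rewrite /= /mrestr; apply: le_lt_trans (ltry 1).
  exact: probability_le1 (measurableI _ _ (measurable_box _ _) mB).
Qed.

(** The interior is a countable union of boxes. Made disjoint they are no longer boxes, but [E]
    intersected with the n-th piece is [E] minus the earlier boxes, intersected with the n-th box,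
    to which [measure_setI_box_eq] applies. *)
Lemma measure_interior_eq (E : set (borelRd R d)) : measurable E ->
  mu (E `&` interior (msupport mu)) = nu (E `&` interior (msupport mu)).
Proof.
move=> mE; have [B [UB HB]] := open_bigcup_ratbox (@open_interior _ (msupport mu)).
have IS : interior (msupport mu) `<=` msupport mu by exact: interior_subset.
have mB n : measurable (B n : set (borelRd R d)).
  by have [a [b [-> _]]] := HB n; exact: measurable_box.
rewrite UB seqDU_bigcup_eq setI_bigcupr.
have mD n : measurable (E `\` \big[setU/set0]_(k < n) B k : set (borelRd R d)).
  by apply: measurableD => //; apply: bigsetU_measurable => k _; exact: mB.
have ED n : E `&` seqDU B n = (E `\` \big[setU/set0]_(k < n) B k) `&` B n.
  by rewrite /seqDU !setDE setIA setIAC.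
have mED n : measurable (E `&` seqDU B n : set (borelRd R d)).
  by rewrite ED; exact: measurableI.
have tED : trivIset setT (fun n => E `&` seqDU B n).
  by apply: trivIset_setIl; exact: trivIset_seqDU.
rewrite !measure_semi_bigcup//; [|exact: bigcupT_measurable|exact: bigcupT_measurable].
apply: eq_eseriesr => n _; rewrite ED.
have [a [b [-> abS]]] := HB n; apply: measure_setI_box_eq; last exact: mD.
by move=> x /abS /IS.
Qed.

End conclusion.

Theorem theorem3p4 (R : realType) (d : nat) (hd : (0 < d)%N)
    (G : 'rV[R]_d -> 'rV[R]_d -> \bar R)
    (hG : G = coulomb_kernel \/ (G = energy_distance_kernel /\ odd d))
    (mu nu : probability (borelRd R d) R)
    (hmu : finite_energy G mu) (hnu : finite_energy G nu)
    (hcrit : lagrangian_critical (mmd_first_variation G nu) mu) :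
  forall A : set (borelRd R d), measurable A ->
    mu (A `&` interior (msupport mu)) = nu (A `&` interior (msupport mu)).
Proof.
have [Phi [N rG]] : exists Phi N, radial_kernel G Phi N.
  have energy : odd d -> exists Phi N, radial_kernel (@energy_distance_kernel R d) Phi N.
    move=> od; have -> : d = d./2.*2.+1 by rewrite -{1}(odd_double_half d) od.
    by eexists; eexists; exact: radial_energy_distance.
  case: hG => [->|[-> od]]; last exact: energy.
  (* In dimension 1 the two kernels coincide and the odd case applies; dimension 2 is the logarithm,
     and from 3 on the kernel is a power. *)
  move: d hd energy {G mu nu hmu hnu hcrit} => [//|[|[|d]]] _ energy.
  - by rewrite coulomb_kernel1; exact: energy.
  - by eexists; eexists; exact: radial_coulomb2.
  - by eexists; eexists; exact: radial_coulomb.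
move=> A; exact: (measure_interior_eq hd rG hmu hnu hcrit).
Qed.
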